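(* Let $(X,\mathcal{E})$ and $(Y,\mathcal{F})$ be uniformly locally finite coarse spaces. The following are equivalent. (i) $(X,\mathcal{E})$ and $(Y,\mathcal{F})$ are bijectively coarsely equivalent. (ii) The algebraic uniform Roe algebras $\mathrm{C}^*_u[X]$ and $\mathrm{C}^*_u[Y]$ are isomorphic. (iii) There is an isomorphism $\Phi\colon \mathrm{C}^*_u(X)\to \mathrm{C}^*_u(Y)$ such that $\Phi(\ell_\infty(X))\subset\ell_\infty(Y)$.
   Context: Coarse structures. A coarse structure on a set $X$ is a collection $\mathcal{E}$ of subsets of $X\times X$ (called entourages) which contains the diagonal $\Delta_X=\{(x,x): x\in X\}$ and is closed under taking subsets, inverses $E^{-1}=\{(x,y):(y,x)\in E\}$, finite unions, and compositions $E\circ F=\{(x,y): \exists z\ (x,z)\in E,\ (z,y)\in F\}$; $(X,\mathcal{E})$ is a coarse space. It is uniformly locally finite if $\sup_{x\in X}|\{y\in X:(x,y)\in E\}|<\infty$ for all $E\in\mathcal{E}$. Coarse maps. Let $(X,\mathcal{E})$, $(Y,\mathcal{F})$ be coarse spaces. Maps $f,g:Z\to X$ from a set $Z$ are close if $\{(f(z),g(z)): z\in Z\}\in\mathcal{E}$. A map $f:X\to Y$ is coarse if for all $E\in\mathcal{E}$ there is $F\in\mathcal{F}$ such that $(x,x')\in E$ implies $(f(x),f(x'))\in F$. A coarse map $f:X\to Y$ is a coarse equivalence if there is a coarse map $g:Y\to X$ such that $g\circ f$ and $f\circ g$ are close to $\mathrm{Id}_X$ and $\mathrm{Id}_Y$.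 The spaces are bijectively coarsely equivalent if there is a coarse equivalence $f:X\to Y$ which is a bijection. Uniform Roe algebras. For $T\in B(\ell_2(X))$ let $\mathrm{supp}(T)=\{(x,x'):\langle T\delta_x,\delta_{x'}\rangle\ne 0\}$. The algebraic uniform Roe algebra is the $*$-algebra $\mathrm{C}^*_u[X]=\{T\in B(\ell_2(X)): \mathrm{supp}(T)\in\mathcal{E}\}$, and the uniform Roe algebra $\mathrm{C}^*_u(X)$ is its norm closure in $B(\ell_2(X))$. $\ell_\infty(X)$ is identified with the operators whose support is contained in $\Delta_X$. Isomorphisms are $*$-isomorphisms (of $*$-algebras, respectively of C*-algebras). *)

(* Defs.v *)
From HB Require Import structures.
From mathcomp Require Import all_boot all_order all_algebra.
From mathcomp Require Import finmap.
From mathcomp Require Import all_classical all_reals.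
From mathcomp Require Import ereal topology normedtype sequences numfun esum.
From mathcomp Require Import complex.
From mathcomp Require Import ring lra.

Set Implicit Arguments.
Unset Strict Implicit.
Unset Printing Implicit Defensive.

Import Order.TTheory GRing.Theory Num.Theory.
Local Open Scope classical_set_scope.
Local Open Scope complex_scope.
Local Open Scope ring_scope.

Import Normc.

(* Sets are modelled by [choiceType]s, as in [esum]; under the classical axioms
   in use every type carries such a structure ([gen_choiceMixin]). *)

Record coarse_structure (X : Type) := CoarseStructure {
  entourage_set :> set (X * X) -> Prop;
  coarse_diag : entourage_set diagonal;
  coarse_sub : forall A B, B `<=` A -> entourage_set A -> entourage_set B;
  coarse_inv : forall A, entourage_set A -> entourage_set [set p | A (p.2, p.1)];
  coarse_setU : forall A B,
    entourage_set A -> entourage_set B -> entourage_set (A `|` B);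
  coarse_comp : forall A B, entourage_set A -> entourage_set B ->
    entourage_set [set p | exists z, A (p.1, z) /\ B (z, p.2)] }.

Definition uniformly_locally_finite (X : Type) (E : coarse_structure X) :=
  forall A, E A -> exists n : nat, forall x, ([set y | A (x, y)] #<= `I_n)%card.

Definition close (Z X : Type) (E : coarse_structure X) (f g : Z -> X) :=
  E (range (fun z => (f z, g z))).

Definition coarse_map (X Y : Type) (E : coarse_structure X)
    (F : coarse_structure Y) (f : X -> Y) :=
  forall A, E A -> exists2 B, F B & forall x x', A (x, x') -> B (f x, f x').

Definition coarse_equivalence (X Y : Type) (E : coarse_structure X)
    (F : coarse_structure Y) (f : X -> Y) :=
  coarse_map E F f /\
  exists g : Y -> X, [/\ coarse_map F E g, close E (g \o f) id
                       & close F (f \o g) id].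

Definition bijectively_coarsely_equivalent (X Y : Type)
    (E : coarse_structure X) (F : coarse_structure Y) :=
  exists2 f : X -> Y, coarse_equivalence E F f & bijective f.

Section Summation.
Variables (R : realType) (X : choiceType).
Implicit Types (u v p q : X -> R) (c d : X -> R[i]).

Definition nnsum u : \bar R := \esum_(x in [set: X]) (u x)%:E.
Arguments nnsum u%_R.

(* Unordered sums, meaningful for absolutely summable families. *)
Definition rsum u : R := fine (nnsum u^\+) - fine (nnsum u^\-).
Definition csum c : R[i] :=
  rsum (fun x => complex.Re (c x)) +i* rsum (fun x => complex.Im (c x)).

Definition rsummable u := (nnsum (fun x => `|u x|%R) < +oo)%E.

Lemma nnsum_ge0 u : (forall x, 0 <= u x) -> (0 <= nnsum u)%E.
Proof. by move=> u0; apply: esum_ge0 => x _; rewrite lee_fin. Qed.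

Lemma nnsum_fin u : (forall x, 0 <= u x) -> (nnsum u < +oo)%E ->
  nnsum u = (fine (nnsum u))%:E.
Proof. by move=> u0 uo; rewrite fineK// ge0_fin_numE// nnsum_ge0. Qed.

Lemma le_nnsum u v : (forall x, u x <= v x) -> (nnsum u <= nnsum v)%E.
Proof. by move=> uv; apply: le_esum => x _; rewrite lee_fin. Qed.

Lemma le_nnsum_lty u v : (forall x, u x <= v x) -> (nnsum v < +oo)%E ->
  (nnsum u < +oo)%E.
Proof. by move=> /le_nnsum; exact: le_lt_trans. Qed.

Lemma nnsumD u v : (forall x, 0 <= u x) -> (forall x, 0 <= v x) ->
  nnsum (fun x => u x + v x) = (nnsum u + nnsum v)%E.
Proof.
move=> u0 v0; rewrite /nnsum -esumD => [|x _|x _]; rewrite ?lee_fin//.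
Qed.

Lemma nnsumZ_le (k : R) u : 0 <= k -> (forall x, 0 <= u x) ->
  (nnsum (fun x => (k * u x)%R) <= k%:E * nnsum u)%E.
Proof.
move=> k0 u0; apply: ge_ereal_sup => _ [A [finA _] <-].
under eq_fsbigr do rewrite EFinM.
rewrite -ge0_mule_fsumr; last by move=> x; rewrite lee_fin.
rewrite lee_wpmul2l ?lee_fin//; apply: esum_ge; exists A => //.
Qed.

Lemma nnsumZ (k : R) u : 0 <= k -> (forall x, 0 <= u x) ->
  nnsum (fun x => k * u x) = (k%:E * nnsum u)%E.
Proof.
move=> k0 u0; apply/eqP; rewrite eq_le nnsumZ_le//=.
have [->|kneq0] := eqVneq k 0.
  by rewrite mul0e nnsum_ge0// => x; rewrite mul0r.
have kgt0 : 0 < k by rewrite lt_neqAle eq_sym kneq0.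
rewrite -lee_pdivlMl//; apply: le_trans; last first.
  apply: nnsumZ_le; first by rewrite invr_ge0 ltW.
  by move=> x; rewrite mulr_ge0// ltW.
by apply: le_nnsum => x; rewrite mulKf// gt_eqF.
Qed.

Lemma rsum_sub u p q : (forall x, 0 <= p x) -> (forall x, 0 <= q x) ->
  (nnsum p < +oo)%E -> (nnsum q < +oo)%E -> (forall x, u x = p x - q x) ->
  rsum u = fine (nnsum p) - fine (nnsum q).
Proof.
move=> p0 q0 sp sq upq.
have up x : u^\+ x <= p x by rewrite /funrpos ge_max p0 upq gerBl q0.
have uq x : u^\- x <= q x by rewrite /funrneg ge_max q0 upq opprB gerBl p0.
have sup := le_nnsum_lty up sp; have suq := le_nnsum_lty uq sq.
have : nnsum (fun x => u^\+ x + q x) = nnsum (fun x => u^\- x + p x).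
  congr nnsum; apply/funext => x.
  have /(congr1 (fun h => h x)) := funrposBneg u.
  by rewrite /= !fctE upq => /eqP; rewrite subr_eq => /eqP ->; ring.
rewrite !nnsumD; [|by []..].
rewrite (nnsum_fin _ sup)// (nnsum_fin _ suq)// (nnsum_fin _ sp)//.
rewrite (nnsum_fin _ sq)// -!EFinD => -[].
by rewrite /rsum; lra.
Qed.

Lemma rsummable_pos u : rsummable u -> (nnsum u^\+ < +oo)%E.
Proof.
apply: le_nnsum_lty => x.
by rewrite /funrpos ge_max ler_norm normr_ge0.
Qed.

Lemma rsummable_neg u : rsummable u -> (nnsum u^\- < +oo)%E.
Proof.
apply: le_nnsum_lty => x.
by rewrite /funrneg ge_max normr_ge0 -normrN ler_norm.
Qed.

Lemma rsumD u v : rsummable u -> rsummable v ->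
  rsum (fun x => u x + v x) = rsum u + rsum v.
Proof.
move=> su sv.
have [sup sun] := (rsummable_pos su, rsummable_neg su).
have [svp svn] := (rsummable_pos sv, rsummable_neg sv).
rewrite (@rsum_sub _ (fun x => u^\+ x + v^\+ x) (fun x => u^\- x + v^\- x)).
- rewrite !nnsumD//.
  rewrite (nnsum_fin _ sup)// (nnsum_fin _ sun)// (nnsum_fin _ svp)//.
  by rewrite (nnsum_fin _ svn)// /rsum /=; ring.
- by move=> x; rewrite addr_ge0.
- by move=> x; rewrite addr_ge0.
- by rewrite nnsumD// lte_add_pinfty.
- by rewrite nnsumD// lte_add_pinfty.
- move=> x; rewrite -[in LHS](funrposBneg u) -[in LHS](funrposBneg v) /= !fctE.
  by ring.
Qed.

Lemma rsumN u : rsum (fun x => - u x) = - rsum u.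
Proof.
rewrite /rsum opprB (_ : (fun x => - u x) = \- u)//.
by rewrite funrposN funrnegN.
Qed.

Lemma nnsumZ_lty k u : 0 <= k -> (forall x, 0 <= u x) -> (nnsum u < +oo)%E ->
  (nnsum (fun x => k * u x)%R < +oo)%E.
Proof.
by move=> k0 u0 su; rewrite nnsumZ// (nnsum_fin u0 su) -EFinM ltry.
Qed.

Lemma fine_nnsumZ k u : 0 <= k -> (forall x, 0 <= u x) -> (nnsum u < +oo)%E ->
  fine (nnsum (fun x => k * u x)) = k * fine (nnsum u).
Proof. by move=> k0 u0 su; rewrite nnsumZ// [in LHS](nnsum_fin u0 su). Qed.

Lemma rsumZ k u : rsummable u -> rsum (fun x => k * u x) = k * rsum u.
Proof.
wlog k0 : k / 0 <= k => [hw su|su].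
  have [k0|k0] := leP 0 k; first exact: hw.
  have /hw/(_ su) : 0 <= - k by rewrite oppr_ge0 ltW.
  rewrite (_ : (fun x => - k * u x) = fun x => - (k * u x)); last first.
    by apply/funext => x; rewrite mulNr.
  by rewrite rsumN mulNr => /oppr_inj.
have [sup sun] := (rsummable_pos su, rsummable_neg su).
rewrite (@rsum_sub _ (fun x => k * u^\+ x) (fun x => k * u^\- x)).
- by rewrite !fine_nnsumZ// /rsum mulrBr.
- by move=> x; rewrite mulr_ge0.
- by move=> x; rewrite mulr_ge0.
- exact: nnsumZ_lty.
- exact: nnsumZ_lty.
- by move=> x; rewrite -mulrBr -[in LHS](funrposBneg u).
Qed.

Lemma le_fine_nnsum u v : (forall x, 0 <= u x) -> (forall x, u x <= v x) ->
  (nnsum v < +oo)%E -> fine (nnsum u) <= fine (nnsum v).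
Proof.
move=> u0 uv sv; have su := le_nnsum_lty uv sv.
have v0 x : 0 <= v x := le_trans (u0 x) (uv x).
by rewrite -lee_fin -(nnsum_fin u0 su) -(nnsum_fin v0 sv) le_nnsum.
Qed.

Lemma normr_rsum u v : (forall x, `|u x| <= v x) -> (nnsum v < +oo)%E ->
  `|rsum u| <= fine (nnsum v).
Proof.
move=> uv sv; have su : rsummable u by exact: le_nnsum_lty sv.
have up : fine (nnsum u^\+) <= fine (nnsum v).
  apply: le_fine_nnsum => // x; apply: le_trans (uv x).
  by rewrite /funrpos ge_max ler_norm normr_ge0.
have un : fine (nnsum u^\-) <= fine (nnsum v).
  apply: le_fine_nnsum => // x; apply: le_trans (uv x).
  by rewrite /funrneg ge_max normr_ge0 -normrN ler_norm.
have up0 : 0 <= fine (nnsum u^\+) by rewrite fine_ge0// nnsum_ge0.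
have un0 : 0 <= fine (nnsum u^\-) by rewrite fine_ge0// nnsum_ge0.
by rewrite /rsum ler_norml; apply/andP; split; lra.
Qed.

Lemma nnsum_single u y : 0 <= u y -> (forall x, x != y -> u x = 0) ->
  nnsum u = (u y)%:E.
Proof.
move=> uy0 u0; transitivity (\esum_(i in [set y]) (EFin \o u) i); last first.
  by rewrite esum_set1 ?lee_fin.
rewrite [RHS]esum_mkcond; apply: eq_esum => x _; case: ifPn => //=.
by move/negP => xy; rewrite u0//; apply/eqP => ?; apply: xy; rewrite inE.
Qed.

Lemma rsum_single u y : (forall x, x != y -> u x = 0) -> rsum u = u y.
Proof.
move=> u0; rewrite /rsum !(@nnsum_single _ y)//=; first 1 last.
- by move=> x /u0; rewrite /funrneg => ->; rewrite oppr0 maxxx.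
- by move=> x /u0; rewrite /funrpos => ->; rewrite maxxx.
- by rewrite -[RHS](congr1 (fun h => h y) (funrposBneg u)).
Qed.

Definition csummable c := (nnsum (fun x => normc (c x)) < +oo)%E.

Lemma normc_ge0 (z : R[i]) : 0 <= normc z.
Proof. by case: z => a b; exact: sqrtr_ge0. Qed.

Lemma sqr_normc (z : R[i]) : normc z ^+ 2 = complex.Re z ^+ 2 + complex.Im z ^+ 2.
Proof. by case: z => a b /=; rewrite sqr_sqrtr// addr_ge0// sqr_ge0. Qed.

Lemma normr_Re_le (z : R[i]) : `|complex.Re z| <= normc z.
Proof.
rewrite -(@ler_pXn2r _ 2) ?nnegrE ?normc_ge0 ?normr_ge0//.
by rewrite sqr_normc real_normK ?num_real// lerDl sqr_ge0.
Qed.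

Lemma normr_Im_le (z : R[i]) : `|complex.Im z| <= normc z.
Proof.
rewrite -(@ler_pXn2r _ 2) ?nnegrE ?normc_ge0 ?normr_ge0//.
by rewrite sqr_normc real_normK ?num_real// lerDr sqr_ge0.
Qed.

Lemma normc_le_ReIm (z : R[i]) : normc z <= `|complex.Re z| + `|complex.Im z|.
Proof.
rewrite -(@ler_pXn2r _ 2) ?nnegrE ?normc_ge0 ?addr_ge0//.
rewrite sqr_normc sqrrD !real_normK ?num_real// lerD2r lerDl.
by rewrite mulrn_wge0// mulr_ge0.
Qed.

Lemma csummable_Re c : csummable c -> rsummable (fun x => complex.Re (c x)).
Proof. by apply: le_nnsum_lty => x; exact: normr_Re_le. Qed.

Lemma csummable_Im c : csummable c -> rsummable (fun x => complex.Im (c x)).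
Proof. by apply: le_nnsum_lty => x; exact: normr_Im_le. Qed.

Lemma csumD c d : csummable c -> csummable d ->
  csum (fun x => c x + d x) = csum c + csum d.
Proof.
move=> sc sd; rewrite /csum; simpc; congr (_ +i* _).
- rewrite -rsumD; [|exact: csummable_Re..].
  by congr rsum; apply/funext => x; case: (c x); case: (d x).
- rewrite -rsumD; [|exact: csummable_Im..].
  by congr rsum; apply/funext => x; case: (c x); case: (d x).
Qed.

Lemma rsummableZ k u : rsummable u -> rsummable (fun x => k * u x).
Proof.
move=> su; rewrite /rsummable.
under [X in nnsum X]eq_fun do rewrite normrM.
exact: nnsumZ_lty.
Qed.

Lemma csumZ a c : csummable c -> csum (fun x => a * c x) = a * csum c.
Proof.
move=> sc; have sR := csummable_Re sc; have sI := csummable_Im sc.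
case: a => a b; rewrite /csum; simpc; congr (_ +i* _).
- rewrite -!rsumZ// -rsumN -rsumD; [|exact: rsummableZ|].
    by congr rsum; apply/funext => x; case: (c x).
  have := rsummableZ (- b) sI; rewrite /rsummable.
  by under eq_fun do rewrite mulNr.
- rewrite -!rsumZ// -rsumD; [|exact: rsummableZ..].
  by congr rsum; apply/funext => x; case: (c x).
Qed.

Lemma csum_conj c : csum (fun x => (c x)^*%C) = (csum c)^*%C.
Proof.
rewrite /csum /conjc -rsumN.
by congr (_ +i* _); congr rsum; apply/funext => x; case: (c x).
Qed.

Lemma normc_csum c u : (forall x, normc (c x) <= u x) -> (nnsum u < +oo)%E ->
  normc (csum c) <= 2 * fine (nnsum u).
Proof.
move=> cu su; apply: le_trans (normc_le_ReIm _) _; rewrite mulr2n mulrDl mul1r.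
apply: lerD; apply: normr_rsum => // x; apply: le_trans (cu x).
- exact: normr_Re_le.
- exact: normr_Im_le.
Qed.

Lemma csum_single c y : (forall x, x != y -> c x = 0) -> csum c = c y.
Proof.
move=> c0; rewrite /csum !(@rsum_single _ y).
- by case: (c y).
- by move=> x /c0 ->.
- by move=> x /c0 ->.
Qed.

End Summation.

Section L2.
Variables (R : realType) (X : choiceType).

Definition sqsum (f : X -> R[i]) : \bar R := nnsum (fun x => normc (f x) ^+ 2).

Definition square_summable : {pred X -> R[i]} := mem [set f | (sqsum f < +oo)%E].

Lemma square_summableP f : reflect (sqsum f < +oo)%E (f \in square_summable).
Proof. by apply: (iffP idP); rewrite inE. Qed.

Lemma sqr_normc_ge0 (z : R[i]) : 0 <= normc z ^+ 2.
Proof. exact: sqr_ge0. Qed.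

Lemma sqr_normcD (a z w : R[i]) :
  normc (a * z + w) ^+ 2 <=
  2 * normc a ^+ 2 * normc z ^+ 2 + 2 * normc w ^+ 2.
Proof.
rewrite -mulrA -exprMn -normcM; move: (a * z) => [x y]; case: w => s t.
rewrite !sqr_normc /=; have := sqr_ge0 (x - s); have := sqr_ge0 (y - t).
by nra.
Qed.

Lemma sqsum_lin a f g : f \in square_summable -> g \in square_summable ->
  a *: f + g \in square_summable /\
  fine (sqsum (a *: f + g)) <=
    2 * normc a ^+ 2 * fine (sqsum f) + 2 * fine (sqsum g).
Proof.
move=> /square_summableP sf /square_summableP sg.
have ka : 0 <= 2 * normc a ^+ 2 by rewrite mulr_ge0 ?sqr_normc_ge0.
pose h x := 2 * normc a ^+ 2 * normc (f x) ^+ 2 + 2 * normc (g x) ^+ 2.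
have fg x : normc ((a *: f + g) x) ^+ 2 <= h x by exact: sqr_normcD.
have f1 := nnsumZ_lty ka (fun x => sqr_normc_ge0 (f x)) sf.
have g1 := nnsumZ_lty (ler0n R 2) (fun x => sqr_normc_ge0 (g x)) sg.
have f0 x : 0 <= 2 * normc a ^+ 2 * normc (f x) ^+ 2.
  by rewrite mulr_ge0 ?sqr_normc_ge0.
have g0 x : 0 <= 2 * normc (g x) ^+ 2 by rewrite mulr_ge0 ?sqr_normc_ge0.
have sh : (nnsum h < +oo)%E by rewrite nnsumD// lte_add_pinfty.
split; first by apply/square_summableP; exact: le_nnsum_lty sh.
apply: le_trans (le_fine_nnsum _ fg sh) _; first by move=> x; exact: sqr_normc_ge0.
rewrite nnsumD// (nnsum_fin f0 f1) (nnsum_fin g0 g1) /=.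
rewrite (fine_nnsumZ ka (fun x => sqr_normc_ge0 (f x)) sf).
by rewrite (fine_nnsumZ (ler0n R 2) (fun x => sqr_normc_ge0 (g x)) sg).
Qed.

Lemma sqsum0 : sqsum 0 = 0%E.
Proof.
by rewrite /sqsum /nnsum esum1// => x _; rewrite [normc _]normc0 expr0n.
Qed.

Lemma square_summable_submod : submod_closed square_summable.
Proof.
split; first by apply/square_summableP; rewrite sqsum0.
by move=> a f g sf sg; case: (sqsum_lin a sf sg).
Qed.

HB.instance Definition _ :=
  GRing.isSubmodClosed.Build _ _ square_summable square_summable_submod.

Record l2 := L2 { l2_fun :> X -> R[i]; _ : l2_fun \in square_summable }.

HB.instance Definition _ := [isSub for l2_fun].
HB.instance Definition _ := [Choice of l2 by <:].
HB.instance Definition _ := [SubChoice_isSubLmodule of l2 by <:].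

Definition l2norm (f : l2) : R := Num.sqrt (fine (sqsum f)).

Definition inner (f g : l2) : R[i] := csum (fun x => f x * (g x)^*%C).

Lemma delta_square_summable (y : X) :
  (fun x => (x == y)%:R : R[i]) \in square_summable.
Proof.
apply/square_summableP; rewrite /sqsum (@nnsum_single _ _ _ y) ?ltry//.
  exact: sqr_normc_ge0.
by move=> x /negPf ->; rewrite normc0 expr0n.
Qed.

Definition delta (y : X) : l2 := L2 (delta_square_summable y).

(* Only used in proofs; it is the square of [l2norm], see [l2norm_sqr]. *)
Definition nsq (f : l2) : R := fine (sqsum f).

Lemma l2P (f : l2) : (sqsum f < +oo)%E.
Proof. exact/square_summableP/valP. Qed.

Lemma nsq_ge0 f : 0 <= nsq f.
Proof. by rewrite fine_ge0// nnsum_ge0// => x; exact: sqr_normc_ge0. Qed.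

Lemma l2norm_sqr f : l2norm f ^+ 2 = nsq f.
Proof. by rewrite sqr_sqrtr// nsq_ge0. Qed.

Lemma nsq_lin a f g : nsq (a *: f + g) <= 2 * normc a ^+ 2 * nsq f + 2 * nsq g.
Proof. by have [] := sqsum_lin a (valP f) (valP g). Qed.

Lemma nsqZ a f : nsq (a *: f) = normc a ^+ 2 * nsq f.
Proof.
rewrite /nsq.
rewrite -(fine_nnsumZ (sqr_normc_ge0 a) (fun x => sqr_normc_ge0 (f x)) (l2P f)).
congr (fine (nnsum _)); apply/funext => x.
by rewrite -exprMn -normcM.
Qed.

Lemma normc_innerE (z w : R[i]) : normc (z * w^*%C) <= normc z ^+ 2 + normc w ^+ 2.
Proof.
rewrite normcM (_ : normc w^*%C = normc w); last first.
  by case: w => a b /=; rewrite sqrrN.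
have := sqr_ge0 (normc z - normc w); have := sqr_normc_ge0 z.
have := sqr_normc_ge0 w; nra.
Qed.

Lemma sum_sq_lty (f g : l2) :
  (nnsum (fun x => normc (f x) ^+ 2 + normc (g x) ^+ 2)%R < +oo)%E.
Proof.
rewrite nnsumD; [|by move=> x; exact: sqr_normc_ge0..].
by rewrite lte_add_pinfty// l2P.
Qed.

Lemma inner_summable (f g : l2) : csummable (fun x => f x * (g x)^*%C).
Proof.
by apply: le_nnsum_lty (sum_sq_lty f g) => x; exact: normc_innerE.
Qed.

Lemma normc_inner_le (f g : l2) : normc (inner f g) <= 2 * (nsq f + nsq g).
Proof.
apply: le_trans (normc_csum _ (sum_sq_lty f g)) _.
  by move=> x; exact: normc_innerE.
rewrite nnsumD; [|by move=> x; exact: sqr_normc_ge0..].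
rewrite (nnsum_fin _ (l2P f)); last by move=> x; exact: sqr_normc_ge0.
by rewrite (nnsum_fin _ (l2P g))// => x; exact: sqr_normc_ge0.
Qed.

Lemma innerC (f g : l2) : inner g f = (inner f g)^*%C.
Proof.
rewrite /inner -csum_conj; congr csum; apply/funext => x.
by rewrite rmorphM /= conjcK mulrC.
Qed.

Lemma inner_linl a (f g h : l2) : inner (a *: f + g) h = a * inner f h + inner g h.
Proof.
rewrite /inner -csumZ; last exact: inner_summable.
rewrite -csumD; last exact: inner_summable.
  by congr csum; apply/funext => x; rewrite /= mulrDl mulrA.
rewrite /csummable.
under eq_fun do rewrite normcM.
apply: nnsumZ_lty; [exact: normc_ge0|by move=> x; exact: normc_ge0|].
exact: inner_summable.
Qed.

Lemma inner0l h : inner 0 h = 0.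
Proof.
have := inner_linl 1 0 0 h; rewrite scaler0 addr0 mul1r.
by move/eqP; rewrite eq_sym -subr_eq0 addrK => /eqP.
Qed.

Lemma inner_deltar f y : inner f (delta y) = f y.
Proof.
rewrite /inner (@csum_single _ _ _ y).
  by rewrite /= eqxx conjc1 mulr1.
by move=> x /negPf xy; rewrite /= xy conjc0 mulr0.
Qed.

Definition bounded_operator : {pred l2 -> l2} :=
  mem [set T | linear T /\ exists M, forall f, l2norm (T f) <= M * l2norm f].

Lemma bounded_operatorP T : reflect
  (linear T /\ exists2 K, 0 <= K & forall f, nsq (T f) <= K * nsq f)
  (T \in bounded_operator).
Proof.
apply: (iffP idP); rewrite inE /= => -[linT].
  move=> [M TM]; split=> //; exists (M ^+ 2); first exact: sqr_ge0.
  move=> f; rewrite -!l2norm_sqr -exprMn lerXn2r ?nnegrE ?sqrtr_ge0//.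
  exact: le_trans (sqrtr_ge0 _) (TM f).
move=> [K K0 TK]; split=> //; exists (Num.sqrt K) => f.
rewrite /l2norm -/(nsq f) -/(nsq (T f)) -sqrtrM// ler_wsqrtr//.
Qed.

Lemma bounded_operator_submod : submod_closed bounded_operator.
Proof.
split.
  apply/bounded_operatorP; split.
    by move=> a f g; rewrite /= scaler0 addr0.
  exists 0 => // f; rewrite mul0r.
  by rewrite /nsq /= (_ : sqsum _ = 0%E)// -sqsum0.
move=> a S T /bounded_operatorP[linS [K K0 SK]] /bounded_operatorP[linT [L L0 TL]].
apply/bounded_operatorP; split.
  move=> b f g; rewrite /= !fctE /= linS linT !scalerDr !scalerA [a * b]mulrC.
  by rewrite addrACA.
exists (2 * normc a ^+ 2 * K + 2 * L).
  by apply: addr_ge0; [apply: mulr_ge0 => //; apply: mulr_ge0 => //|apply: mulr_ge0 => //]; apply: sqr_normc_ge0.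
move=> f; apply: le_trans (nsq_lin _ _ _) _.
have a0 : 0 <= 2 * normc a ^+ 2 by apply: mulr_ge0 => //; exact: sqr_normc_ge0.
have Sa := ler_wpM2l a0 (SK f); have Ta := TL f.
rewrite [leRHS](_ : _ = 2 * normc a ^+ 2 * (K * nsq f) + 2 * (L * nsq f)); last by ring.
by apply: lerD => //; rewrite ler_wpM2l.
Qed.

HB.instance Definition _ :=
  GRing.isSubmodClosed.Build _ _ bounded_operator bounded_operator_submod.

Record bop := Bop { bop_fun :> l2 -> l2; _ : bop_fun \in bounded_operator }.

HB.instance Definition _ := [isSub for bop_fun].
HB.instance Definition _ := [Choice of bop by <:].
HB.instance Definition _ := [SubChoice_isSubLmodule of bop by <:].

Lemma comp_bounded (S T : bop) : (S : l2 -> l2) \o T \in bounded_operator.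
Proof.
have /bounded_operatorP[linS [K K0 SK]] := valP S.
have /bounded_operatorP[linT [L L0 TL]] := valP T.
apply/bounded_operatorP; split=> [a f g|]; first by rewrite /= linT linS.
exists (K * L); first exact: mulr_ge0.
by move=> f; apply: le_trans (SK _) _; rewrite -mulrA ler_wpM2l.
Qed.

Definition bop_comp (S T : bop) : bop := Bop (comp_bounded S T).

Definition opnorm (T : bop) : R :=
  sup [set l2norm (T f) | f in [set f : l2 | l2norm f <= 1]].

Definition is_adjoint (T S : bop) :=
  forall f g, inner (T f) g = inner f (S g).

(* An adjoint always exists ([adjointP]), so the default [0] is never taken. *)
Definition adjoint (T : bop) : bop := xget 0 [set S | is_adjoint T S].

Lemma finite_approx (h : X -> R[i]) (s : seq X) : uniq s ->
  exists xi : l2, [/\ forall y, xi y = if y \in s then h y else 0,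
    nsq xi = \sum_(x <- s) normc (h x) ^+ 2 &
    forall L : l2 -> R[i], (forall a f g, L (a *: f + g) = a * L f + L g) ->
      L xi = \sum_(x <- s) h x * L (delta x)].
Proof.
elim: s => [_|x s IHs /= /andP[xs /IHs[xi [xiE nxi Lxi]]]].
  exists 0; split=> //; first by rewrite big_nil /nsq (_ : sqsum _ = 0%E)// -sqsum0.
  move=> L linL; rewrite big_nil; have := linL 1 0 0.
  by rewrite scaler0 addr0 mul1r => /eqP; rewrite eq_sym -subr_eq0 addrK => /eqP.
have xiE' y : (h x *: delta x + xi) y = if y \in x :: s then h y else 0.
  rewrite -[LHS]/(h x * (y == x)%:R + xi y) xiE inE.
  have [->|_] /= := eqVneq y x; first by rewrite (negPf xs) mulr1 addr0.
  by rewrite mulr0 add0r.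
exists (h x *: delta x + xi); split=> //.
  pose d y := if y == x then normc (h x) ^+ 2 else 0.
  have d0 y : 0 <= d y by rewrite /d; case: ifP => // _; exact: sqr_normc_ge0.
  have dx : nnsum d = (normc (h x) ^+ 2)%:E.
    by rewrite (@nnsum_single _ _ _ x) /d ?eqxx ?sqr_normc_ge0// => y /negPf ->.
  rewrite /nsq (_ : sqsum _ = (nnsum d + sqsum xi)%E); last first.
    rewrite -nnsumD//; last by move=> y; exact: sqr_normc_ge0.
    congr nnsum; apply/funext => y; rewrite xiE' xiE inE /d.
    have [->|_] /= := eqVneq y x; last by rewrite add0r.
    by rewrite (negPf xs) normc0 expr0n addr0.
  rewrite dx /sqsum (nnsum_fin _ (l2P xi)); last by move=> y; exact: sqr_normc_ge0.
  by rewrite /= big_cons -nxi.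
by move=> L linL; rewrite linL big_cons Lxi.
Qed.

Lemma finite_dense (f : l2) (e : R) : 0 < e -> exists s : seq X, uniq s /\
  forall xi : l2, (forall y, xi y = if y \in s then f y else 0) ->
    nsq xi = \sum_(x <- s) normc (f x) ^+ 2 -> nsq (-1 *: xi + f) < e.
Proof.
move=> e0.
have f0 (h : l2) x : 0 <= normc (h x) ^+ 2 by exact: sqr_normc_ge0.
have : ((nsq f - e)%:E < sqsum f)%E.
  by rewrite [X in (_ < X)%E](nnsum_fin (f0 f) (l2P f)) lte_fin ltrBlDr ltrDl.
move=> /ereal_sup_gt[_ [A [finA _] <-]].
rewrite fsbig_finite//= sumEFin lte_fin => Ae.
exists (fset_set A : seq X); split; first exact: fset_uniq.
move=> xi xiE nxi.
suff : nsq f = nsq (-1 *: xi + f) + nsq xi by rewrite nxi; lra.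
rewrite {1}/nsq (_ : sqsum f = (sqsum (-1 *: xi + f)%R + sqsum xi)%E); last first.
  rewrite -nnsumD; [|exact: f0..].
  congr nnsum; apply/funext => y.
  rewrite -[(-1 *: xi + f) y]/(-1 * xi y + f y) xiE.
  case: ifP => _; first by rewrite mulN1r addNr normc0 expr0n add0r.
  by rewrite mulr0 add0r normc0 expr0n addr0.
by rewrite /sqsum (nnsum_fin (f0 _) (l2P (-1 *: xi + f))) (nnsum_fin (f0 _) (l2P xi)).
Qed.

Lemma normc_real (r : R) : 0 <= r -> normc r%:C = r.
Proof. by move=> r0; rewrite /= expr0n addr0 sqrtr_sqr ger0_norm. Qed.

Lemma functional_eq0 (L : l2 -> R[i]) (B C : R) :
  (forall a f g, L (a *: f + g) = a * L f + L g) -> 0 <= B ->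
  (forall f, normc (L f) <= B * nsq f + C) ->
  (forall x, L (delta x) = 0) -> forall f, L f = 0.
Proof.
move=> linL B0 LB Ld f; apply: eq0_normc.
have L0 : L 0 = 0.
  have := linL 1 0 0; rewrite scaler0 addr0 mul1r.
  by move/eqP; rewrite eq_sym -subr_eq0 addrK => /eqP.
have bnd t : 0 < t -> t * normc (L f) <= B + C.
  move=> t0; have t2 : 0 < t ^- 2 by rewrite invr_gt0 exprn_gt0.
  have [s [us sP]] := finite_dense f t2.
  have [xi [xiE nxi Lxi]] := finite_approx f us.
  have Lxi0 : L xi = 0 by rewrite Lxi// big1// => x _; rewrite Ld mulr0.
  have := LB (t%:C *: (-1 *: xi + f)).
  rewrite -[X in L X]addr0 linL L0 addr0 linL Lxi0 mulr0 add0r normcM.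
  rewrite nsqZ !(normc_real (ltW t0)) => /le_trans; apply.
  rewrite lerD2r -[leRHS]mulr1 ler_wpM2l//.
  by rewrite -ler_pdivlMl ?exprn_gt0// mulr1 ltW// sP.
apply/eqP; rewrite eq_le normc_ge0 andbT leNgt; apply/negP => d0.
have BC : 0 <= B + C by apply: le_trans (bnd 1 ltr01); rewrite mul1r normc_ge0.
have := bnd ((B + C + 1) / normc (L f)).
rewrite divfK ?gt_eqF// divr_gt0 ?ltr_wpDl// => /(_ isT).
by rewrite leNgt ltrDl ltr01.
Qed.

Lemma opnorm_ge (T : bop) f : l2norm f <= 1 -> l2norm (T f) <= opnorm T.
Proof.
move=> f1; have := valP T; rewrite inE /= => -[_ [M TM]].
apply: ub_le_sup; last by exists f.
exists `|M| => _ [g /= g1 <-]; apply: le_trans (TM g) _.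
rewrite (le_trans (ler_wpM2r (sqrtr_ge0 _) (ler_norm M)))//.
by rewrite ler_piMr.
Qed.

Lemma inner_linr a (f g h : l2) :
  inner f (a *: g + h) = a^*%C * inner f g + inner f h.
Proof.
by rewrite (innerC g f) (innerC h f) (innerC (a *: g + h) f) inner_linl rmorphD rmorphM.
Qed.

Lemma mul_conjc (z : R[i]) : z^*%C * z = (normc z^*%C ^+ 2)%:C.
Proof.
case: z => a b; rewrite sqr_normc; apply/eqP; rewrite eq_complex.
by apply/andP; split; apply/eqP; rewrite /=; ring.
Qed.

Section Adjoint.
Variable T : bop.

Definition adjoint_val (g : l2) (x : X) : R[i] := (inner (T (delta x)) g)^*%C.

Lemma bop_linear (S : bop) a f g : S (a *: f + g) = a *: S f + S g.
Proof. by have /bounded_operatorP[linS _] := valP S; exact: linS. Qed.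

Lemma bop0 (S : bop) : S 0 = 0.
Proof.
by have := bop_linear S (-1) 0 0; rewrite scaler0 addr0 scaleN1r addNr.
Qed.

Lemma adjoint_val_bound : exists2 K, 0 <= K & forall g,
  (sqsum (adjoint_val g) <= (K * nsq g)%:E)%E.
Proof.
have /bounded_operatorP[_ [K K0 TK]] := valP T.
exists (16 * (K + 1)); first by rewrite mulr_ge0// addr_ge0.
move=> g; apply: ge_ereal_sup => _ [A [finA _] <-].
rewrite fsbig_finite//= sumEFin lee_fin.
have [xi [_ nxi Lxi]] := finite_approx (adjoint_val g) (fset_uniq (fset_set A)).
rewrite -nxi.
have {}Lxi : inner (T xi) g = (nsq xi)%:C.
  rewrite (Lxi (fun f => inner (T f) g)); last first.
    by move=> a f h; rewrite bop_linear inner_linl.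
  rewrite nxi rmorph_sum; apply: eq_bigr => x _.
  exact: mul_conjc.
pose r := (4 * (K + 1))^-1.
have K1 : 0 < K + 1 by rewrite ltr_wpDl.
have r0 : 0 < r by rewrite invr_gt0 mulr_gt0.
have := normc_inner_le (T (r%:C *: xi)) g.
have -> : inner (T (r%:C *: xi)) g = r%:C * inner (T xi) g.
  by rewrite -[_ *: xi]addr0 bop_linear bop0 inner_linl inner0l addr0.
rewrite Lxi normcM (normc_real (ltW r0)) (normc_real (nsq_ge0 xi)).
have : nsq (T (r%:C *: xi)) <= K * (r ^+ 2 * nsq xi).
  by have := TK (r%:C *: xi); rewrite nsqZ (normc_real (ltW r0)).
set N := nsq xi; set G := nsq g; set Q := nsq (T _) => QN NQ.
have rK : r * (4 * (K + 1)) = 1 by rewrite mulVf// gt_eqF// mulr_gt0.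
have N0 : 0 <= N := nsq_ge0 _.
clearbody r N G Q.
have rN : 0 <= r * N by rewrite mulr_ge0// ltW.
have rrN : 0 <= r * (r * N) by rewrite mulr_ge0// ltW.
have e1 : r * N = 4 * (K * (r ^+ 2 * N)) + 4 * (r * (r * N)).
  by transitivity (r * N * (r * (4 * (K + 1)))); [rewrite rK mulr1|ring].
have e2 : r * N <= 4 * G by lra.
have e3 : N = 4 * (K + 1) * (r * N).
  by transitivity (N * (r * (4 * (K + 1)))); [rewrite rK mulr1|ring].
rewrite e3 (_ : 16 * (K + 1) * G = 4 * (K + 1) * (4 * G)); last by ring.
by rewrite ler_wpM2l// mulr_ge0// ltW.
Qed.

Lemma adjoint_val_summable g : adjoint_val g \in square_summable.
Proof.
have [K K0 TK] := adjoint_val_bound.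
by apply/square_summableP; exact: le_lt_trans (TK g) (ltry _).
Qed.

Let S (g : l2) : l2 := L2 (adjoint_val_summable g).

Lemma adjoint_exists : exists S, is_adjoint T S.
Proof.
have linS : linear S.
  move=> a f g; apply/val_inj/funext => x.
  rewrite -[LHS]/(inner (T (delta x)) (a *: f + g))^*%C.
  by rewrite inner_linr rmorphD rmorphM /= conjcK.
have SB : S \in bounded_operator.
  apply/bounded_operatorP; split=> //.
  have [K K0 TK] := adjoint_val_bound; exists K => // g.
  by rewrite -lee_fin -nnsum_fin ?TK// ?l2P// => x; exact: sqr_normc_ge0.
exists (Bop SB) => f g /=.
apply/eqP; rewrite -subr_eq0; apply/eqP.
have /bounded_operatorP[_ [K K0 TK]] := valP T.
pose L f := inner (T f) g - inner f (S g).
apply: (@functional_eq0 L (2 * K + 2) (2 * nsq g + 2 * nsq (S g))).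
- by move=> a h k; rewrite /L bop_linear !inner_linl; ring.
- by rewrite addr_ge0// mulr_ge0.
- move=> h; have := normc_inner_le (T h) g; have := normc_inner_le h (S g).
  have := TK h; set z := inner _ _; set w := inner _ _ => a b c.
  have : normc (L h) <= normc w + normc z.
    have nN (v : R[i]) : normc (- v) = normc v.
      by case: v => p q /=; rewrite !sqrrN.
    rewrite -[normc z]nN -lecR rmorphD /=.
    exact: (ler_normD w (- z)).
  by lra.
- move=> x; rewrite /L [inner (delta x) _]innerC inner_deltar.
  by rewrite -[S g x]/(adjoint_val g x) /adjoint_val conjcK subrr.
Qed.
End Adjoint.

Lemma adjointP T : is_adjoint T (adjoint T).
Proof. by have [S TS] := adjoint_exists T; exact: (xgetPex 0 (ex_intro _ S TS)). Qed.
End L2.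

Section UniformRoe.
Variables (R : realType) (X : choiceType) (E : coarse_structure X).

Definition supp (T : bop R X) : set (X * X) :=
  [set p | inner (T (delta R p.1)) (delta R p.2) != 0].

Definition algebraic_uniform_roe : set (bop R X) := [set T | E (supp T)].

Definition uniform_roe : set (bop R X) :=
  [set T | forall e : R, 0 < e ->
     exists2 S, algebraic_uniform_roe S & opnorm (T - S) < e].

Definition linfty : set (bop R X) := [set T | supp T `<=` diagonal].
End UniformRoe.
Arguments algebraic_uniform_roe R {X} E.
Arguments uniform_roe R {X} E.
Arguments linfty : clear implicits.

(* [A] and [B] are meant to be *-subalgebras; [Phi] is only relevant on [A]. *)
Definition star_isomorphism (R : realType) (X Y : choiceType)
    (A : set (bop R X)) (B : set (bop R Y)) (Phi : bop R X -> bop R Y) :=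
  [/\ set_bij A B Phi,
      forall (a : R[i]) S T, A S -> A T -> Phi (a *: S + T) = a *: Phi S + Phi T,
      forall S T, A S -> A T -> Phi (bop_comp S T) = bop_comp (Phi S) (Phi T)
    & forall S, A S -> Phi (adjoint S) = adjoint (Phi S)].

(* Main.v *)
Require Import Defs.
From mathcomp Require Import all_boot all_order all_fingroup all_algebra.
From mathcomp Require Import finmap.
From mathcomp Require Import all_classical all_reals.
From mathcomp Require Import ereal numfun esum.
From mathcomp Require Import complex.
From mathcomp Require Import ring lra.

(* A bijective coarse equivalence induces a unitary conjugating one pair of
   algebras onto the other.  Conversely, given an isomorphism [Phi], the images
   [p x] of the minimal projections onto the coordinate lines are minimal, hence
   supported on squares [S x * S x].
   In the diagonal case each [S x] is a single point [f x]; matrix units go to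
   unimodular multiples of matrix units, and approximating the image of the 0-1
   matrix of an entourage by an operator of controlled support shows that [f] is
   coarse.
   In the algebraic case each [S x] is finite.  For a generic bounded diagonal
   operator [D], no entry of [Phi D] over [S x * S x] cancels, so one entourage
   contains all these squares.  Independence of the ranges of the [p x] provides
   nonzero minors, hence an injection [X -> Y] selecting points of the [S x];
   compactness and the Cantor-Bernstein argument turn it and its analogue for
   the inverse of [Phi] into a bijection [f] with [f x] in [S x]. *)

Set Implicit Arguments.
Unset Strict Implicit.
Unset Printing Implicit Defensive.
Import Order.TTheory GRing.Theory Num.Theory.
Local Open Scope classical_set_scope.
Local Open Scope complex_scope.
Local Open Scope ring_scope.
Import Normc.

(** * Combinatorics *)

(** Each forbidden value is attained at most once by an injective sequence. *)
Lemma injective_avoid (T : eqType) (J : eqType) (v : nat -> T) (b : J -> T)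
    (s : seq J) : injective v -> exists m, forall j, j \in s -> v m != b j.
Proof.
(* Strengthened to all large [m], so that the thresholds for the elements of [s] combine by
   [maxn]. *)
move=> vI; suff [N NP] : exists N, forall m j, (N <= m)%N -> j \in s -> v m != b j.
  by exists N => j; exact: NP.
elim: s => [|i s [N NP]]; first by exists 0%N.
have [[m0 m0P]|nbad] := pselect (exists m, v m = b i).
  exists (maxn N m0.+1) => m j; rewrite geq_max => /andP[Nm m0m].
  rewrite inE => /predU1P[->|]; last exact: NP.
  rewrite -m0P; apply/negP => /eqP/vI mm0.
  by rewrite mm0 ltnn in m0m.
exists N => m j Nm; rewrite inE => /predU1P[->|]; last exact: NP.
by apply/negP => /eqP vm; apply: nbad; exists m.
Qed.

(** * Well-orders: transitivity, well-foundedness, maxima of finite lists *)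

Section WellOrder.
Variables (X : eqType) (le : rel X).
Hypothesis wo_le : wochoice.well_order le.

Let wo_chain_le : wochoice.wo_chain le predT.
Proof. by move=> A _; exact: wo_le. Qed.

Lemma well_order_total : total le.
Proof. by move=> x y; exact: (wochoice.wo_chainW wo_chain_le). Qed.

Lemma well_order_anti : antisymmetric le.
Proof. by move=> x y; exact: (wochoice.wo_chain_antisymmetric wo_chain_le). Qed.

Lemma well_order_refl : reflexive le.
Proof. by move=> x; exact: (wochoice.wo_chain_reflexive wo_chain_le). Qed.

(** The least element of {x, y, z} is [x], or else antisymmetry identifies two neighbours. *)
Lemma well_order_trans : transitive le.
Proof.
move=> y x z xy yz.
have [|w [[wA wmin] _]] := wo_le (A := mem [:: x; y; z]); first by exists x; rewrite inE eqxx.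
have wz : le w z by apply: wmin; rewrite !inE eqxx !orbT.
have wx : le w x by apply: wmin; rewrite !inE eqxx.
have wy : le w y by apply: wmin; rewrite !inE eqxx !orbT.
move: wA; rewrite !inE => /or3P[]/eqP wE; first by rewrite -wE.
  by rewrite (@well_order_anti x y) // xy -wE.
by rewrite -(@well_order_anti y z) // yz -wE.
Qed.

Lemma well_order_wf : well_founded (fun x y => le x y && (x != y)).
Proof.
set lt := fun x y => _; move=> x; apply: contrapT => nAx.
pose A : {pred X} := fun y => `[< ~ Acc lt y >].
have [|z [[/asboolW zA zmin] _]] := wo_le (A := A); first by exists x; apply/asboolT.
apply: zA; constructor => y /andP[yz /eqP neq_yz].
apply: contrapT => nAy; apply: neq_yz; apply: well_order_anti.
by rewrite yz; apply: zmin; apply/asboolT.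
Qed.

Lemma well_order_seq_max (s : seq X) x0 : x0 \in s ->
  exists2 x, x \in s & forall y, y \in s -> le y x.
Proof.
elim: s x0 => // x [_ _ _|y s IHs _ _].
  by exists x; rewrite ?mem_seq1// => y; rewrite mem_seq1 => /eqP->; exact: well_order_refl.
have [z zs zmax] := IHs y (mem_head _ _).
have /orP[xz|zx] := well_order_total x z.
  exists z; first by rewrite inE zs orbT.
  by move=> t; rewrite inE => /predU1P[->//|/zmax].
exists x; first by rewrite inE eqxx.
move=> t; rewrite inE => /predU1P[->|/zmax tz]; first exact: well_order_refl.
exact: well_order_trans zx.
Qed.
End WellOrder.

(* The weights are chosen by transfinite recursion along a well-order of [X]:
   the weight of [x] decides whether the sums whose last nonzero term is at [x]
   vanish, and only finitely many values are forbidden. *)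
Lemma generic_weights (X J : eqType) (K : fieldType) (v : nat -> K)
    (c : J -> X -> K) (S : J -> seq X) (T : X -> seq J) :
  injective v -> (forall j, uniq (S j)) ->
  (forall j x, c j x != 0 -> x \in S j) ->
  (forall j x, c j x != 0 -> j \in T x) ->
  exists n : X -> nat, forall j x, c j x != 0 ->
    \sum_(x <- S j) v (n x) * c j x != 0.
Proof.
move=> vI uS cS cT.
have [le wo] := wochoice.well_ordering_principle X.
pose lt x y := le x y && (x != y).
(* [before] is the part of the sum for [j] whose weights are fixed before stage [x]; [ok] excludes
   the one value at [x] that would cancel it. *)
pose before x (n : forall y, lt y x -> nat) (j : J) : K :=
  \sum_(y <- S j) match pselect (lt y x) with
                  | left yx => v (n y yx) * c j y
                  | right _ => 0
                  end.
pose ok x n m := forall j, j \in T x -> v m != - before x n j / c j x.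
have okP x n : {m | ok x n m}.
  by apply: cid; exact: (injective_avoid (fun j => - before x n j / c j x) (T x) vI).
pose n := Fix (well_order_wf wo) (fun=> nat) (fun x n => projT1 (okP x n)).
have nE x : n x = projT1 (okP x (fun y _ => n y)).
  rewrite /n Fix_eq// => y f g fg; congr (projT1 (okP _ _)).
  by apply/functional_extensionality_dep => z; apply/functional_extensionality_dep.
exists n => j x0 cx0.
(* At the largest [x] with [c j x] nonzero, the whole sum is the term at [x] plus [before], which
   [ok] keeps from vanishing. *)
have [|x] := @well_order_seq_max _ _ wo [seq x <- S j | c j x != 0] x0.
  by rewrite mem_filter cx0 cS.
rewrite mem_filter => /andP[cx xS] xmax.
have /(_ j (cT _ _ cx)) : ok x (fun y _ => n y) (n x) by rewrite nE; case: (okP _ _).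
apply: contraNN => /eqP; rewrite (bigD1_seq x)//= => sum0.
rewrite eq_sym -(mulfK cx (v (n x))) -subr_eq0 -mulrBl mulf_eq0 invr_eq0 (negPf cx) orbF.
rewrite -opprD oppr_eq0 addrC -[X in _ == X]sum0; apply/eqP; congr (_ + _).
rewrite /before (bigD1_seq x)//=.
case: pselect => [|_]; first by rewrite /lt eqxx andbF.
rewrite add0r; apply: eq_bigr => y yx; case: pselect => // ltyx.
have [->|cy] := eqVneq (c j y) 0; first by rewrite mulr0.
have yS := cS _ _ cy.
by move: ltyx; rewrite /lt yx andbT xmax// mem_filter cy yS.
Qed.

(** A maximal minor is nonzero, hence so is some term of its Leibniz expansion; the permutation of
    that term gives [g]. *)
Lemma row_free_injection (K : fieldType) m n (M : 'M[K]_(m, n)) : row_free M ->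
  exists2 g : 'I_m -> 'I_n, injective g & forall i, M i (g i) != 0.
Proof.
move=> freeM.
have fullM : row_full M^T by rewrite /row_full mxrank_tr.
have := fullrowsub_unit fullM; rewrite unitmxE unitfE.
set N := rowsub _ _; have -> : \det N = \det N^T by rewrite det_tr.
move=> /negP detN; have [s sP] : exists s : 'S_m, forall i, N^T i (s i) != 0.
  apply: contrapT => /forallNP nos; apply: detN; rewrite /determinant big1// => s _.
  have /existsNP[i /negP] := nos s; rewrite negbK => /eqP Ni.
  by rewrite (bigD1 i)//= Ni mul0r mulr0.
exists (fun i => fullrankfun fullM (s i)).
  by move=> i j /fullrankfun_inj /perm_inj.
by move=> i; have := sP i; rewrite !mxE.
Qed.

(* The selection is the limit of selections on finite sets along an ultrafilter. *)
Lemma injective_selection (X Y : eqType) (S : X -> seq Y) :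
  (forall s : seq X, exists h : X -> Y,
    {in s &, injective h} /\ forall x, x \in s -> h x \in S x) ->
  exists2 f : X -> Y, injective f & forall x, f x \in S x.
Proof.
move=> finS.
pose B (s : seq X) := [set h : X -> Y |
  {in s &, injective h} /\ forall x, x \in s -> h x \in S x].
(* [B (s ++ t)] is contained in both [B s] and [B t]. *)
have FF : Filter (filter_from setT B).
  apply: filter_from_filter; first by exists [::].
  move=> s t _ _; exists (s ++ t) => // h [hI hS].
  split; split=> [x y xs ys|x xs]; [apply: hI|apply: hS|apply: hI|apply: hS];
    by rewrite mem_cat ?xs ?ys ?orbT.
have PF := filter_from_proper FF (fun s _ => finS s).
have [U [UU sub]] := ultraFilterLemma PF.
have UB s : U (B s) by apply: sub; exists s.
(* On [B [:: x]] the value [h x] ranges over the finite list [S x], so the ultrafilter settles on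
   one value. *)
have lim x : {y | U [set h | h x = y]}.
  apply: cid; apply: contrapT => /forallNP none.
  have : U [set h | h x \notin S x].
    elim: (S x) => [|y r IHr]; first by apply: filterS (@filterT _ U _).
    have [/none//|] := in_ultra_setVsetC [set h : X -> Y | h x = y] UU.
    move=> /(filterI IHr); apply: filterS => h /= [hr /eqP hy].
    by rewrite inE negb_or hy.
  move=> Un; have Ux : U (B [:: x] `&` [set h | h x \notin S x]) by exact: filterI.
  have [h [[_ /(_ x)]]] := filter_ex Ux.
  by rewrite /= mem_seq1 eqxx => /(_ isT) ->.
exists (fun x => projT1 (lim x)).
  move=> x y; case: (lim x) (lim y) => [z Uz] [t Ut] /= zt.
  have Uxy : U ([set h | h x = z] `&` [set h | h y = t] `&` B [:: x; y]).
    by apply: filterI => //; exact: filterI.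
  have [h [[/= hz ht] [hI _]]] := filter_ex Uxy.
  by apply: hI; rewrite ?inE ?eqxx ?orbT// hz ht.
move=> x; case: (lim x) => z /= Uz.
have Ux : U ([set h | h x = z] `&` B [:: x]) by exact: filterI.
have [h [/= hz [_ /(_ x)]]] := filter_ex Ux.
by rewrite mem_seq1 eqxx hz => /(_ isT).
Qed.

(** The second conclusion keeps [h] inside any relation that contains the graph of [f] and the
    inverse graph of [g]. *)
Lemma Cantor_Bernstein_graph (X Y : Type) (f : X -> Y) (g : Y -> X) :
  injective f -> injective g ->
  exists2 h : X -> Y, bijective h & forall x, h x = f x \/ x = g (h x).
Proof.
move=> fI gI.
(* [C] collects the forward orbits under [g \o f] of the points outside the range of [g]; [h] is [f]
   on [C] and the inverse of [g] off it. *)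
pose C := [set x | exists n z, ~ range g z /\ x = iter n (g \o f) z].
have out x : ~ C x -> exists y, x = g y.
  move=> nCx; apply: contrapT => nx; apply: nCx; exists 0%N, x; split=> //.
  by move=> [y _ yx]; apply: nx; exists y.
have /choice[h hP] : forall x, exists y, (C x -> y = f x) /\ (~ C x -> x = g y).
  move=> x;   have [Cx|nCx] := pselect (C x); first by exists (f x).
  by have [y xy] := out x nCx; exists y.
have Cgf x : C x -> C (g (f x)).
  by move=> [n [z [nz ->]]]; exists n.+1, z.
have inC x x' : C x -> h x = h x' -> C x'.
  move=> Cx hE; apply: contrapT => nCx'; apply: (nCx').
  by rewrite ((hP x').2 nCx') -hE ((hP x).1 Cx); exact: Cgf.
have hI : injective h.
  move=> x x' hE; have [Cx|nCx] := pselect (C x).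
    have Cx' := inC _ _ Cx hE.
    by apply: fI; rewrite -((hP x).1 Cx) -((hP x').1 Cx').
  have nCx' : ~ C x' by move=> Cx'; apply: nCx; exact: inC Cx' (esym hE).
  by rewrite ((hP x).2 nCx) ((hP x').2 nCx') hE.
have /choice[k kP] : forall y, exists x, h x = y.
  move=> y;   have [Cgy|nCgy] := pselect (C (g y)); last first.
    by exists (g y); apply: gI; rewrite -((hP _).2 nCgy).
  move: Cgy => [[|n] [z [nz gyE]]]; first by case: nz; exists y.
  exists (iter n (g \o f) z); rewrite (hP _).1; last by exists n, z.
  by apply: gI; rewrite gyE.
exists h; first by exists k => // x; apply: hI; rewrite kP.
by move=> x; have [/(hP x).1|/(hP x).2] := pselect (C x); [left|right].
Qed.

(** * Operators on [l2] *)

Section Operators.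
Variables (R : realType) (X : choiceType).
Implicit Types (f g : l2 R X) (S T : bop R X) (x y z : X).

Lemma l2_ext f g : (forall x, f x = g x) -> f = g.
Proof. by move=> fg; apply/val_inj/funext. Qed.

Lemma bop_ext S T : (forall f, S f = T f) -> S = T.
Proof. by move=> ST; apply/val_inj/funext. Qed.

Lemma l2DE f g x : (f + g) x = f x + g x. Proof. by []. Qed.
Lemma l2ZE (a : R[i]) f x : (a *: f) x = a * f x. Proof. by []. Qed.
Lemma l20E x : (0 : l2 R X) x = 0. Proof. by []. Qed.
Lemma bopDE S T f : (S + T) f = S f + T f. Proof. by []. Qed.
Lemma bopBE S T f : (S - T) f = S f - T f. Proof. by []. Qed.
Lemma bopZE (a : R[i]) T f : (a *: T) f = a *: T f. Proof. by []. Qed.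
Lemma bop0E f : (0 : bop R X) f = 0. Proof. by []. Qed.
Lemma bop_compE S T f : bop_comp S T f = S (T f). Proof. by []. Qed.

Lemma bopD T f g : T (f + g) = T f + T g.
Proof. by have := bop_linear T 1 f g; rewrite !scale1r. Qed.

Lemma bopZ T (a : R[i]) f : T (a *: f) = a *: T f.
Proof. by have := bop_linear T a f 0; rewrite bop0 !addr0. Qed.

Lemma deltaE x y : delta R x y = (y == x)%:R. Proof. by []. Qed.

(** Moving [T] to the other side of the inner product with [delta y] replaces a continuity
    argument. *)
Lemma bop_entryE T f y : T f y = csum (fun z => f z * T (delta R z) y).
Proof.
rewrite -[LHS]inner_deltar adjointP /inner; congr csum; apply/funext => z.
by rewrite -(inner_deltar (adjoint T _)) -innerC -adjointP inner_deltar.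
Qed.

Lemma csum_eq0 (c : X -> R[i]) : (forall x, c x = 0) -> csum c = 0.
Proof.
move=> c0; have -> : c = (fun x => 0 * c x) by apply/funext => x; rewrite mul0r c0.
(* [csum_single] needs an index, so an empty [X] is treated apart. *)
have [x|x0] := pselect (exists x : X, True).
  by case: x => x _; rewrite (@csum_single _ _ _ x) ?mul0r // => y _; rewrite mul0r.
rewrite /csum /rsum /nnsum.
rewrite !esum1 ?subrr// => x; by exfalso; apply: x0; exists x.
Qed.

Lemma bop_eq0P T f y : (forall z, f z != 0 -> T (delta R z) y = 0) -> T f y = 0.
Proof.
move=> fT; rewrite bop_entryE; apply: csum_eq0 => z.
by have [->|/fT->] := eqVneq (f z) 0; rewrite ?mul0r ?mulr0.
Qed.

Lemma bop_ext_delta S T : (forall x, S (delta R x) = T (delta R x)) -> S = T.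
Proof.
move=> ST; apply: bop_ext => f; apply: l2_ext => y; rewrite !bop_entryE.
by congr csum; apply/funext => z; rewrite ST.
Qed.

Lemma suppE T x y : supp T (x, y) <-> T (delta R x) y != 0.
Proof. by rewrite /supp /= inner_deltar. Qed.

Lemma bop_neq0 T : T != 0 -> exists x y, T (delta R x) y != 0.
Proof.
move=> T0; apply: contrapT => none; move/eqP: T0; apply.
apply: bop_ext_delta => x; apply: l2_ext => y; apply/eqP/negP => Txy.
by apply: none; exists x, y; apply/negP.
Qed.

Lemma nnsum_nsq f : sqsum f = (nsq f)%:E.
Proof. by rewrite /sqsum nnsum_fin ?l2P// => x; exact: sqr_normc_ge0. Qed.

Lemma nsq_ge_sum f (s : seq X) : uniq s -> \sum_(x <- s) normc (f x) ^+ 2 <= nsq f.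
Proof.
move=> us; rewrite -lee_fin -nnsum_nsq.
apply: esum_ge; exists [set` s]; first by split=> //; exact: finite_seq.
by rewrite -sumEFin fsbig_seq//.
Qed.

Lemma nsq_le_sum f (K : R) :
  (forall s : seq X, uniq s -> \sum_(x <- s) normc (f x) ^+ 2 <= K) -> nsq f <= K.
Proof.
move=> fK; rewrite -lee_fin -nnsum_nsq; apply: ge_ereal_sup => _ [A [finA _] <-].
by rewrite fsbig_finite//= sumEFin lee_fin; apply: fK; exact: fset_uniq.
Qed.

Lemma nsq_ge f x : normc (f x) ^+ 2 <= nsq f.
Proof. by have := @nsq_ge_sum f [:: x] isT; rewrite big_seq1. Qed.

Lemma nsq_delta x : nsq (delta R x) = 1.
Proof.
rewrite /nsq /sqsum (@nnsum_single _ _ _ x) /=; last first.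
- by move=> y /negPf ->; rewrite normc0 expr0n.
- exact: sqr_normc_ge0.
by rewrite eqxx normc1 expr1n.
Qed.

Lemma nsq0 : nsq (0 : l2 R X) = 0.
Proof. exact: (congr1 fine (sqsum0 R X)). Qed.

Lemma nsqD f g : nsq (f + g) <= 2 * nsq f + 2 * nsq g.
Proof.
have := nsq_lin 1 f g; rewrite scale1r (_ : normc (1 : R[i]) = 1) ?normc1//.
by rewrite expr1n mulr1.
Qed.

Lemma inner_nsq f : inner f f = (nsq f)%:C.
Proof.
rewrite /inner; have -> : (fun x => f x * (f x)^*%C) = fun x => (normc (f x) ^+ 2)%:C.
  apply/funext => x; case: (f x) => a b; rewrite Defs.sqr_normc.
  by apply/eqP; rewrite eq_complex; apply/andP; split; apply/eqP; rewrite /=; ring.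
have f0 x : 0 <= normc (f x) ^+ 2 := sqr_normc_ge0 (f x).
have n0 : @nnsum R X (fun=> 0) = 0%E by rewrite /nnsum esum1.
rewrite /csum /=; congr (_ +i* _).
  rewrite (@rsum_sub _ _ _ (fun x => normc (f x) ^+ 2) (fun=> 0)) ?n0 ?ltry ?l2P//.
    by rewrite subr0.
  by move=> x; rewrite subr0.
by rewrite (@rsum_sub _ _ _ (fun=> 0) (fun=> 0)) ?n0 ?ltry ?subrr// => x; rewrite subrr.
Qed.

Fact mxunit_bounded x y : (fun f : l2 R X => f x *: delta R y) \in @bounded_operator R X.
Proof.
apply/bounded_operatorP; split=> [a f g|]; first by rewrite l2DE l2ZE scalerDl scalerA.
by exists 1 => // f; rewrite nsqZ nsq_delta mulr1 mul1r nsq_ge.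
Qed.

(** The matrix unit from [delta x] to [delta y]: source first, in agreement with [supp]. *)
Definition mxunit x y : bop R X := Bop (mxunit_bounded x y).

Lemma mxunitE x y f : mxunit x y f = f x *: delta R y. Proof. by []. Qed.

Lemma comp_mxunitl T x y f : bop_comp (mxunit x y) T f = T f x *: delta R y.
Proof. by []. Qed.

Lemma comp_mxunitr T x y f : bop_comp T (mxunit x y) f = f x *: T (delta R y).
Proof. by rewrite bop_compE mxunitE bopZ. Qed.

(** Matrix entries are thus visible in the algebra structure, which lets an isomorphism transport
    them. *)
Lemma comp_mxunit2 T x y z t :
  bop_comp (mxunit z t) (bop_comp T (mxunit x y)) = T (delta R y) z *: mxunit x t.
Proof.
apply: bop_ext => f; rewrite comp_mxunitl comp_mxunitr l2ZE bopZE mxunitE scalerA.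
by rewrite mulrC.
Qed.

Lemma mxunit_entry x y z t : mxunit x y (delta R z) t = ((z == x) && (t == y))%:R.
Proof. by rewrite mxunitE l2ZE !deltaE -natrM mulnb [x == z]eq_sym. Qed.

Lemma mxunit_neq0 x y : mxunit x y != 0.
Proof.
apply/eqP => e0; have := mxunit_entry x y x y; rewrite e0 bop0E l20E !eqxx.
by move/eqP; rewrite eq_sym oner_eq0.
Qed.

Lemma supp_mxunit x y : supp (mxunit x y) = [set (x, y)].
Proof.
apply/seteqP; split=> [[z t] /suppE|_ ->]; last first.
  by apply/suppE; rewrite mxunit_entry !eqxx oner_neq0.
rewrite mxunit_entry; case: andP => [[/eqP-> /eqP->]//|_].
by rewrite eqxx.
Qed.

Lemma adjoint_unique T S : is_adjoint T S -> adjoint T = S.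
Proof.
move=> TS; apply: bop_ext => g; apply: l2_ext => x.
rewrite -[LHS]inner_deltar -[RHS]inner_deltar innerC [RHS]innerC.
by rewrite -adjointP TS.
Qed.

Lemma adjoint_entry T x y : adjoint T (delta R x) y = (T (delta R y) x)^*%C.
Proof. by rewrite -inner_deltar innerC -adjointP inner_deltar. Qed.

Lemma adjoint_lin (a : R[i]) S T :
  adjoint (a *: S + T) = a^*%C *: adjoint S + adjoint T.
Proof.
apply: adjoint_unique => f g.
by rewrite bopDE bopZE inner_linl bopDE bopZE inner_linr conjcK -!adjointP.
Qed.

Lemma adjointZ (a : R[i]) T : adjoint (a *: T) = a^*%C *: adjoint T.
Proof.
have adj0 : adjoint (0 : bop R X) = 0.
  by apply: adjoint_unique => f g; rewrite !bop0E inner0l innerC inner0l conjc0.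
by rewrite -[a *: T]addr0 adjoint_lin adj0 addr0.
Qed.

Lemma adjoint_mxunit x y : adjoint (mxunit x y) = mxunit y x.
Proof.
apply: bop_ext_delta => z; apply: l2_ext => t.
by rewrite adjoint_entry !mxunit_entry conjc_nat andbC.
Qed.

(* The constant is not 1 because [normc_inner_le] is weaker than Cauchy-Schwarz. *)
Lemma adjoint_nsq_le T (K : R) : 0 < K -> (forall f, nsq (T f) <= K * nsq f) ->
  forall f, nsq (adjoint T f) <= 16 * K * nsq f.
Proof.
move=> K0 TK f; set N := nsq (adjoint T f).
have N0 : 0 <= N := nsq_ge0 _.
(* With this scaling, the quadratic term that [normc_inner_le] produces for [r T T^* f] is at most
   half of [r * N] and is absorbed. *)
pose r := (4 * K)^-1; have r0 : 0 < r by rewrite invr_gt0 mulr_gt0.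
have rK : 4 * (r * K) = 1 by rewrite /r; field; rewrite gt_eqF.
have := normc_inner_le (r%:C *: T (adjoint T f)) f.
rewrite -[_ *: _]addr0 inner_linl inner0l addr0 adjointP inner_nsq addr0.
rewrite normcM !normc_real ?(ltW r0) ?nsq_ge0// nsqZ normc_real ?(ltW r0)//.
have := TK (adjoint T f); rewrite -/N; set M := nsq (T _) => MN.
have : r ^+ 2 * M <= r ^+ 2 * (K * N) by rewrite ler_wpM2l// exprn_ge0// ltW.
have -> : r ^+ 2 * (K * N) = r * N * (r * K) by ring.
have -> : r * K = 1 / 4 by lra.
move=> h1 h2; have h3 : r * N <= 4 * nsq f by lra.
have -> : N = 4 * K * (r * N) by rewrite /r; field; rewrite gt_eqF.
by rewrite (_ : 16 * K * nsq f = 4 * K * (4 * nsq f)) ?ler_wpM2l ?mulr_ge0 ?(ltW K0)//; ring.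
Qed.

Lemma opnorm_ge0 T : 0 <= opnorm T.
Proof.
have l0 : l2norm (0 : l2 R X) = 0 by rewrite /l2norm -/(nsq _) nsq0 sqrtr0.
by have := @opnorm_ge _ _ T 0; rewrite bop0 l0 ler01; apply.
Qed.

Lemma nsq_opnorm T f : nsq (T f) <= opnorm T ^+ 2 * nsq f.
Proof.
have [f0|f0] := eqVneq (nsq f) 0.
  have -> : f = 0.
    apply: l2_ext => x; apply/eq0_normc/eqP; rewrite -sqrf_eq0 eq_le sqr_ge0 andbT.
    by rewrite -f0 nsq_ge.
  by rewrite bop0 nsq0 mulr0.
have fgt0 : 0 < nsq f by rewrite lt_neqAle eq_sym f0 nsq_ge0.
(* [opnorm] is a supremum over the unit ball, so [f] is normalised. *)
pose r := (l2norm f)^-1.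
have r0 : 0 <= r by rewrite invr_ge0 sqrtr_ge0.
have r2 : r ^+ 2 = (nsq f)^-1 by rewrite exprVn l2norm_sqr.
have : l2norm (T (r%:C *: f)) <= opnorm T.
  apply: opnorm_ge; rewrite -(@ler_pXn2r _ 2) ?nnegrE ?sqrtr_ge0//.
  by rewrite l2norm_sqr nsqZ normc_real// r2 mulVf// expr1n.
rewrite -(@ler_pXn2r _ 2) ?nnegrE ?sqrtr_ge0 ?opnorm_ge0//.
by rewrite l2norm_sqr bopZ nsqZ normc_real// r2 ler_pdivrMl// mulrC.
Qed.

Lemma opnorm_le T (K : R) : 0 <= K -> (forall f, nsq (T f) <= K ^+ 2 * nsq f) ->
  opnorm T <= K.
Proof.
move=> K0 TK; apply: ge_sup.
  exists (l2norm (T 0)), 0 => //=.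
  by rewrite /l2norm -/(nsq _) nsq0 sqrtr0.
move=> _ [f /= f1 <-]; rewrite -(@ler_pXn2r _ 2) ?nnegrE ?sqrtr_ge0//.
rewrite l2norm_sqr (le_trans (TK f))// ler_piMr ?exprn_ge0//.
by rewrite -l2norm_sqr exprn_ile1 ?sqrtr_ge0.
Qed.

End Operators.

(** * Bounded operators from uniformly sparse matrices *)

Section SparseOperators.
Variables (R : realType) (X : choiceType).

(** Splitting off one term costs a factor 2; the crude constant depends only on the number of
    terms. *)
Lemma sqr_normc_sum (I : Type) (s : seq I) (c : I -> R[i]) n : (size s <= n)%N ->
  normc (\sum_(i <- s) c i) ^+ 2 <= 2 ^+ n * \sum_(i <- s) normc (c i) ^+ 2.
Proof.
elim: s n => [|i s IHs] n; first by rewrite !big_nil normc0 expr0n mulr0.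
case: n => // n /IHs sn; rewrite !big_cons.
have := sqr_normcD 1 (c i) (\sum_(j <- s) c j).
rewrite mul1r normc1 expr1n mulr1 => /le_trans; apply.
rewrite mulrDr lerD//.
  by rewrite ler_wpM2r ?sqr_ge0// [2 ^+ n.+1]exprS ler_peMr// exprn_ege1// ler1n.
by rewrite [2 ^+ n.+1]exprS -mulrA ler_wpM2l.
Qed.

(** Each output coordinate is a sum of at most [n] terms and each input coordinate enters at most
    [n] outputs; exchanging sums bounds the squared norm by [2 ^ n * n]. *)
Lemma sparse_operator (k : X -> X -> R[i]) (s d : X -> seq X) n :
  (forall x y, normc (k x y) <= 1) -> (forall y, uniq (s y)) ->
  (forall y, (size (s y) <= n)%N) -> (forall x, (size (d x) <= n)%N) ->
  (forall x y, x \in s y -> y \in d x) ->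
  exists T : bop R X, forall f y, T f y = \sum_(x <- s y) k x y * f x.
Proof.
move=> k1 us sn dn sd.
pose K : R := 2 ^+ n * n%:R.
have bound (f : l2 R X) (t : seq X) : uniq t ->
    \sum_(y <- t) normc (\sum_(x <- s y) k x y * f x) ^+ 2 <= K * nsq f.
  (* One finite list of inputs for all outputs in [t], so that the double sum can be exchanged. *)
  move=> ut; pose u := undup (flatten (map s t)).
  have tu y : y \in t -> {subset s y <= u}.
    by move=> yt x xs; rewrite mem_undup; apply/flatten_mapP; exists y.
  apply: (@le_trans _ _ (\sum_(y <- t) 2 ^+ n * \sum_(x <- u | x \in s y) normc (f x) ^+ 2)).
    rewrite big_seq [leRHS]big_seq; apply: ler_sum => y yt.
    apply: le_trans (sqr_normc_sum _ (sn y)) _; rewrite ler_wpM2l ?exprn_ge0//.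
    apply: (@le_trans _ _ (\sum_(x <- s y) normc (f x) ^+ 2)).
      apply: ler_sum => x _; rewrite normcM exprMn ler_piMl ?sqr_ge0//.
      by rewrite exprn_ile1 ?normc_ge0.
    have suP : perm_eq (s y) [seq x <- u | x \in s y].
      apply: uniq_perm => //; first by rewrite filter_uniq// undup_uniq.
      by move=> x; rewrite mem_filter; have [/(tu y yt)->|] := boolP (x \in s y).
    by rewrite (perm_big _ suP) big_filter.
  rewrite -mulr_sumr /K -mulrA ler_wpM2l ?exprn_ge0//.
  rewrite (exchange_big_dep predT)//=.
  apply: (@le_trans _ _ (n%:R * \sum_(x <- u) normc (f x) ^+ 2)).
    rewrite mulr_sumr; apply: ler_sum => x _.
    rewrite -big_filter big_const_seq count_predT iter_addr_0 -[leLHS]mulr_natl.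
    rewrite ler_wpM2r ?sqr_ge0// ler_nat; apply: leq_trans (dn x).
    apply: uniq_leq_size; first by rewrite filter_uniq.
    by move=> y; rewrite mem_filter => /andP[/sd].
  by rewrite ler_wpM2l// nsq_ge_sum// undup_uniq.
have sq (f : l2 R X) : (fun y => \sum_(x <- s y) k x y * f x) \in @square_summable R X.
  apply/square_summableP; apply: le_lt_trans (ltry (K * nsq f)).
  apply: ge_ereal_sup => _ [A [finA _] <-].
  by rewrite fsbig_finite//= sumEFin lee_fin; apply: bound; exact: fset_uniq.
have bT : (fun f => L2 (sq f)) \in @bounded_operator R X.
  apply/bounded_operatorP; split=> [a f g|].
    apply: l2_ext => y; rewrite l2DE l2ZE /= mulr_sumr -big_split/=.
    by apply: eq_bigr => x _; transitivity (k x y * (a * f x + g x)); [|ring].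
  exists K => [|f]; first by rewrite mulr_ge0// exprn_ge0.
  by apply: nsq_le_sum => t ut; exact: bound.
by exists (Bop bT).
Qed.

Lemma diag_operator (a : X -> R[i]) : (forall x, normc (a x) <= 1) ->
  exists T : bop R X, forall f x, T f x = a x * f x.
Proof.
move=> a1; pose s (x : X) := [:: x].
have [//|//|//|//|x y|T TE] := @sparse_operator (fun x _ => a x) s s 1.
  by rewrite !mem_seq1 eq_sym.
by exists T => f x; rewrite TE big_seq1.
Qed.

(** Uniform local finiteness of [A] and of its inverse makes the 0-1 matrix of [A] sparse in both
    directions. *)
Lemma entourage_operator (E : coarse_structure X) (A : set (X * X)) :
  uniformly_locally_finite E -> E A ->
  exists T : bop R X, forall x y, T (delta R x) y = (`[< A (x, y) >])%:R.
Proof.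
move=> ulfE EA; have [n An] := ulfE _ EA; have [m Am] := ulfE _ (coarse_inv EA).
have fin_row y : finite_set [set x | A (x, y)].
  by apply: card_le_finite (Am y) _; exact: finite_II.
have fin_col x : finite_set [set y | A (x, y)].
  by apply: card_le_finite (An x) _; exact: finite_II.
pose s y := fset_set [set x | A (x, y)] : seq X.
pose d x := fset_set [set y | A (x, y)] : seq X.
have [|||||T TE] := @sparse_operator (fun _ _ => 1) s d (maxn n m).
- by move=> _ _; rewrite normc1.
- by move=> y; exact: fset_uniq.
- by move=> y; apply: leq_trans (leq_maxr n m); exact: geq_card_fset_set (Am y).
- by move=> x; apply: leq_trans (leq_maxl n m); exact: geq_card_fset_set (An x).
- by move=> x y; rewrite !in_fset_set// !inE.
exists T => x y; rewrite TE.
have sP : (x \in s y) = `[< A (x, y) >] by rewrite in_fset_set// asboolE inE.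
have [Axy|nAxy] := boolP (x \in s y).
  rewrite -sP Axy (bigD1_seq x) ?fset_uniq// deltaE eqxx mulr1 big1 => [|z /negPf zx].
    by exact: addr0.
  by rewrite deltaE zx mulr0.
rewrite -sP (negPf nAxy) big_seq big1// => z zs; rewrite deltaE.
by have [zx|_] := eqVneq z x; rewrite ?mulr0//; rewrite -zx zs in nAxy.
Qed.
End SparseOperators.

(** * Closure properties of the algebraic and uniform Roe algebras *)

Section Algebras.
Variables (R : realType) (X : choiceType) (E : coarse_structure X).

(** These properties hold for both Roe algebras, so one analysis of minimal projections serves both
    rigidity arguments. *)
Record roe_algebra (A : set (bop R X)) : Prop := RoeAlgebra {
  roe_lin : forall a S T, A S -> A T -> A (a *: S + T);
  roe_comp : forall S T, A S -> A T -> A (bop_comp S T);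
  roe_adjoint : forall S, A S -> A (adjoint S);
  roe_supp : forall S, E (supp S) -> A S }.

Lemma algebraic_roe_algebra : roe_algebra (algebraic_uniform_roe R E).
Proof.
rewrite /algebraic_uniform_roe; split=> /=.
- move=> a S T ES ET; apply: coarse_sub (coarse_setU ES ET) => -[x y] /suppE.
  rewrite bopDE bopZE l2DE l2ZE => h.
  have [S0|/suppE] := eqVneq (S (delta R x) y) 0; last by left.
  by right; apply/suppE; move: h; rewrite S0 mulr0 add0r.
- move=> S T ES ET; apply: coarse_sub (coarse_comp ET ES) => -[x y] /suppE /=.
  move=> h; apply: contrapT => none; move/eqP: h; apply.
  apply: bop_eq0P => z Txz; apply/eqP/negP => /negP Szy; apply: none.
  by exists z; split; apply/suppE.
- move=> S ES; apply: coarse_sub (coarse_inv ES) => -[x y] /suppE /=.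
  rewrite adjoint_entry => h; apply/suppE; apply: contraNN h => /eqP->.
  by rewrite conjc0.
- by [].
Qed.

(** Squared norms avoid square roots and suprema in the approximation arguments. *)
Lemma uniform_roeP (T : bop R X) : uniform_roe R E T <->
  forall e : R, 0 < e -> exists2 S, E (supp S) & forall f, nsq (T f - S f) <= e * nsq f.
Proof.
split=> TE e e0.
  (* Since [r <= 1], the square of the operator norm is at most [r], hence at most [e]. *)
  pose r := Num.min 1 e; have r0 : 0 < r by rewrite lt_min ltr01.
  have [S ES TS] := TE r r0; exists S => // f.
  apply: le_trans (nsq_opnorm (T - S) f) _; rewrite ler_wpM2r ?nsq_ge0//.
  have o0 := opnorm_ge0 (T - S); have : r <= 1 by rewrite ge_min lexx.
  have : r <= e by rewrite ge_min lexx orbT.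
  nra.
have [S ES TS] := TE ((e / 2) ^+ 2) (exprn_gt0 _ (divr_gt0 e0 (ltr0n _ 2))).
exists S => //; apply: (@le_lt_trans _ _ (e / 2)); last by lra.
by apply: opnorm_le => //; lra.
Qed.

Lemma uniform_roe_algebra : roe_algebra (uniform_roe R E).
Proof.
have [alin acomp aadj _] := algebraic_roe_algebra.
have bnd (T : bop R X) : exists2 K, 0 < K & forall f, nsq (T f) <= K * nsq f.
  exists (opnorm T ^+ 2 + 1) => [|f]; first by rewrite ltr_wpDl ?sqr_ge0.
  by apply: le_trans (nsq_opnorm T f) _; rewrite ler_wpM2r ?nsq_ge0// lerDl.
split.
- move=> a S T /uniform_roeP US /uniform_roeP UT; apply/uniform_roeP => e e0.
  (* The factor of the first term in [nsq_lin], increased by 1 so that one may divide by it when [a]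
     is 0. *)
  pose c := 2 * normc a ^+ 2 + 1; have c0 : 0 < c by rewrite ltr_wpDl// mulr_ge0// sqr_ge0.
  have [S1 ES1 SS1] := US (e / 2 / c) (divr_gt0 (divr_gt0 e0 (ltr0n _ 2)) c0).
  have [T1 ET1 TT1] := UT (e / 4) (divr_gt0 e0 (ltr0n _ 4)).
  exists (a *: S1 + T1); first exact: alin.
  move=> f; rewrite !bopDE !bopZE.
  rewrite (_ : _ - _ = a *: (S f - S1 f) + (T f - T1 f)); last first.
    by rewrite scalerBr opprD addrACA.
  apply: le_trans (nsq_lin _ _ _) _.
  have := SS1 f; have := TT1 f; have := nsq_ge0 (S f - S1 f); have := nsq_ge0 f.
  set u := nsq f; set v := nsq _; set w := nsq (_ - _) => u0 v0 wu vu.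
  have : c * v <= e / 2 * u.
    have := ler_wpM2l (ltW c0) vu; rewrite (_ : c * (e / 2 / c * u) = e / 2 * u)//.
    by field; rewrite gt_eqF.
  by rewrite /c; lra.
- move=> S T /uniform_roeP US /uniform_roeP UT; apply/uniform_roeP => e e0.
  have [K K0 SK] := bnd S.
  (* [T] is approximated first: the bound [L] of [T1] decides how well [S] must be approximated, as
     ST - S1 T1 = S (T - T1) + (S - S1) T1. *)
  have [T1 ET1 TT1] := UT (e / 4 / K) (divr_gt0 (divr_gt0 e0 (ltr0n _ 4)) K0).
  have [L L0 TL] := bnd T1.
  have [S1 ES1 SS1] := US (e / 4 / L) (divr_gt0 (divr_gt0 e0 (ltr0n _ 4)) L0).
  exists (bop_comp S1 T1); first exact: acomp.
  move=> f; rewrite !bop_compE.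
  rewrite (_ : _ - _ = S (T f - T1 f) + (S (T1 f) - S1 (T1 f))); last first.
    by rewrite -[- T1 f]scaleN1r bopD bopZ scaleN1r addrA subrK.
  apply: le_trans (nsqD _ _) _.
  have h1 := le_trans (SK (T f - T1 f)) (ler_wpM2l (ltW K0) (TT1 f)).
  have eL0 : 0 <= e / 4 / L by rewrite !divr_ge0// ltW.
  have h2 := le_trans (SS1 (T1 f)) (ler_wpM2l eL0 (TL f)).
  have e1 : K * (e / 4 / K * nsq f) = e / 4 * nsq f by field; rewrite gt_eqF.
  have e2 : e / 4 / L * (L * nsq f) = e / 4 * nsq f by field; rewrite gt_eqF.
  by rewrite e1 in h1; rewrite e2 in h2; lra.
- move=> S /uniform_roeP US; apply/uniform_roeP => e e0.
  (* The 16 offsets the constant in [adjoint_nsq_le]. *)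
  have [S1 ES1 SS1] := US (e / 16) (divr_gt0 e0 (ltr0n _ 16)).
  exists (adjoint S1); first exact: aadj.
  move=> f; have := @adjoint_nsq_le _ _ (S - S1) (e / 16) _ SS1 f.
  rewrite (_ : adjoint (S - S1) = adjoint S - adjoint S1); last first.
    by rewrite -[- S1]scaleN1r addrC adjoint_lin rmorphN1 scaleN1r addrC.
  rewrite bopBE => /(_ (divr_gt0 e0 (ltr0n _ 16)))/le_trans; apply.
  by have -> : 16 * (e / 16) = e by field.
- move=> S ES; apply/uniform_roeP => e e0; exists S => // f.
  by rewrite subrr nsq0 mulr_ge0 ?nsq_ge0// ltW.
Qed.

Lemma roe_diag (A : set (bop R X)) T : roe_algebra A -> supp T `<=` diagonal -> A T.
Proof. by move=> algA dT; apply: (roe_supp algA); exact: coarse_sub dT (coarse_diag E). Qed.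

Lemma roe_mxunit (A : set (bop R X)) : roe_algebra A -> forall x, A (mxunit R x x).
Proof. by move=> algA x; apply: (roe_diag algA); rewrite supp_mxunit => _ ->. Qed.

Lemma roe0 (A : set (bop R X)) : roe_algebra A -> A 0.
Proof.
by move=> algA; apply: (roe_diag algA) => -[z t] /suppE; rewrite bop0E l20E eqxx.
Qed.
End Algebras.

(** * Operators transported by a bijection *)

Section Transport.
Variables (R : realType) (X Y : choiceType) (f : X -> Y) (g : Y -> X).
Hypotheses (fK : cancel f g) (gK : cancel g f).

Lemma nnsum_comp (u : Y -> R) : nnsum (u \o f) = nnsum u.
Proof.
rewrite /nnsum (@reindex_esum R X Y setT setT f)//.
by split=> // [x y _ _ /(can_inj fK)|y _]; last by exists (g y).
Qed.

Lemma csum_comp (c : Y -> R[i]) : csum (c \o f) = csum c.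
Proof.
have rsum_comp (u : Y -> R) : rsum (u \o f) = rsum u.
  by congr (fine _ - fine _); [exact: (nnsum_comp u^\+)|exact: (nnsum_comp u^\-)].
congr (_ +i* _); first exact: (rsum_comp (fun y => complex.Re (c y))).
exact: (rsum_comp (fun y => complex.Im (c y))).
Qed.

Fact l2_comp_subproof (xi : l2 R Y) : (xi : Y -> R[i]) \o f \in @square_summable R X.
Proof.
apply/square_summableP.
by rewrite /sqsum (nnsum_comp (fun y => normc (xi y) ^+ 2)) l2P.
Qed.

Definition l2_comp (xi : l2 R Y) : l2 R X := L2 (l2_comp_subproof xi).

Lemma l2_compE xi x : l2_comp xi x = xi (f x). Proof. by []. Qed.

Lemma nsq_l2_comp xi : nsq (l2_comp xi) = nsq xi.
Proof. by congr (fine _); exact: (nnsum_comp (fun y => normc (xi y) ^+ 2)). Qed.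

Lemma inner_l2_comp xi eta : inner (l2_comp xi) (l2_comp eta) = inner xi eta.
Proof. exact: (csum_comp (fun y => xi y * (eta y)^*%C)). Qed.

Lemma l2_comp_lin a xi eta : l2_comp (a *: xi + eta) = a *: l2_comp xi + l2_comp eta.
Proof. exact: l2_ext. Qed.

Lemma l2_comp_delta x : l2_comp (delta R (f x)) = delta R x.
Proof.
by apply: l2_ext => z; rewrite l2_compE !deltaE (inj_eq (can_inj fK)).
Qed.
End Transport.

Section Transport2.
Variables (R : realType) (X Y : choiceType) (f : X -> Y) (g : Y -> X).
Hypotheses (fK : cancel f g) (gK : cancel g f).

Let U := @l2_comp R _ _ _ _ gK fK.
Let V := @l2_comp R _ _ _ _ fK gK.

Let UV : cancel V U. Proof. by move=> xi; apply: l2_ext => y; rewrite !l2_compE gK. Qed.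
Let VU : cancel U V. Proof. by move=> xi; apply: l2_ext => y; rewrite !l2_compE fK. Qed.

Fact bop_transport_subproof (T : bop R X) :
  (fun eta => U (T (V eta))) \in @bounded_operator R Y.
Proof.
apply/bounded_operatorP; split=> [a xi eta|].
  by rewrite [V _]l2_comp_lin bop_linear [LHS]l2_comp_lin.
exists (opnorm T ^+ 2) => [|eta]; first exact: sqr_ge0.
by rewrite [leLHS]nsq_l2_comp -(nsq_l2_comp fK gK eta) nsq_opnorm.
Qed.

(** Conjugation by the unitary [U], which sends [delta x] to [delta (f x)] and has inverse [V]. *)
Definition bop_transport (T : bop R X) : bop R Y := Bop (bop_transport_subproof T).

Lemma bop_transport_entry T y y' :
  bop_transport T (delta R y) y' = T (delta R (g y)) (g y').
Proof.
rewrite -[LHS]/(T (V (delta R y)) (g y')); congr ((T _ : l2 R X) _).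
by rewrite -{1}(gK y) [LHS]l2_comp_delta.
Qed.

Lemma bop_transport_lin a S T :
  bop_transport (a *: S + T) = a *: bop_transport S + bop_transport T.
Proof.
apply: bop_ext => eta; rewrite -[LHS]/(U ((a *: S + T) (V eta))) bopDE bopZE.
exact: l2_comp_lin.
Qed.

Lemma bop_transport_comp S T :
  bop_transport (bop_comp S T) = bop_comp (bop_transport S) (bop_transport T).
Proof.
apply: bop_ext => eta; rewrite -[LHS]/(U (S (T (V eta)))).
by rewrite -[RHS]/(U (S (V (U (T (V eta)))))) VU.
Qed.

Lemma bop_transport_adjoint T : bop_transport (adjoint T) = adjoint (bop_transport T).
Proof.
apply/esym/adjoint_unique => xi eta.
rewrite -[LHS]/(inner (U (T (V xi))) eta) -[RHS]/(inner xi (U (adjoint T (V eta)))).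
by rewrite -{1}(UV eta) -{2}(UV xi) ![inner (U _) (U _)]inner_l2_comp adjointP.
Qed.

Lemma supp_bop_transport T :
  supp (bop_transport T) = [set p | supp T (g p.1, g p.2)].
Proof.
apply/seteqP; split=> -[y y'] /=.
  by move=> /suppE; rewrite bop_transport_entry => /suppE.
by move=> /suppE; rewrite -bop_transport_entry => /suppE.
Qed.

Lemma nsq_bop_transport (T : bop R X) (K : R) : (forall xi, nsq (T xi) <= K * nsq xi) ->
  forall eta, nsq (bop_transport T eta) <= K * nsq eta.
Proof.
by move=> TK eta; rewrite [leLHS]nsq_l2_comp -(nsq_l2_comp fK gK eta).
Qed.

Section Roe.
Variables (E : coarse_structure X) (F : coarse_structure Y).
Hypothesis cf : coarse_map E F f.

Lemma entourage_bop_transport T : E (supp T) -> F (supp (bop_transport T)).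
Proof.
move=> /cf[B FB TB]; rewrite supp_bop_transport; apply: coarse_sub FB => -[y y'] /= /TB.
by rewrite !gK.
Qed.

Lemma uniform_roe_bop_transport T :
  uniform_roe R E T -> uniform_roe R F (bop_transport T).
Proof.
move=> /uniform_roeP UT; apply/uniform_roeP => e /UT[S ES TS].
exists (bop_transport S); first exact: entourage_bop_transport.
move=> eta; have := @nsq_bop_transport (T - S) e TS eta.
rewrite -scaleN1r addrC bop_transport_lin.
by rewrite bopDE bopZE scaleN1r addrC.
Qed.
End Roe.
End Transport2.

(** * From bijective coarse equivalences to isomorphisms *)

Section BijectiveEquivalence.
Variables (R : realType) (X Y : choiceType).
Variables (E : coarse_structure X) (F : coarse_structure Y).

(** The given coarse inverse [h] may differ from [g], but h y = h (f (g y)) is close to g y; the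
    entourage follows the path g y, h y, h y', g y'. *)
Lemma bijective_equivalence_inverse (f : X -> Y) (g : Y -> X) : cancel f g ->
  cancel g f -> coarse_equivalence E F f -> coarse_map F E g.
Proof.
move=> fK gK [cf [h [ch hf _]]] B /ch[A EA AB].
eexists; first exact: coarse_comp (coarse_comp (coarse_inv hf) EA) hf.
move=> y y' /AB Ah; exists (h y'); split; last by exists (g y') => //=; rewrite gK.
by exists (h y); split=> //; exists (g y) => //=; rewrite gK.
Qed.

Lemma bijective_equivalence_iso : bijectively_coarsely_equivalent E F ->
  exists Phi : bop R X -> bop R Y,
  [/\ star_isomorphism (algebraic_uniform_roe R E) (algebraic_uniform_roe R F) Phi,
      star_isomorphism (uniform_roe R E) (uniform_roe R F) Phi &
      Phi @` linfty R X `<=` linfty R Y].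
Proof.
move=> [f ef [g fK gK]]; have cg := bijective_equivalence_inverse fK gK ef.
have cf := ef.1.
pose Phi := @bop_transport R _ _ _ _ fK gK; pose Psi := @bop_transport R _ _ _ _ gK fK.
have PhiK : cancel Phi Psi.
  move=> T; apply: bop_ext_delta => x; apply: l2_ext => x'.
  by rewrite [LHS]bop_transport_entry [LHS]bop_transport_entry !fK.
have PsiK : cancel Psi Phi.
  move=> T; apply: bop_ext_delta => x; apply: l2_ext => x'.
  by rewrite [LHS]bop_transport_entry [LHS]bop_transport_entry !gK.
have iso (A : set (bop R X)) (B : set (bop R Y)) : (forall T, A T -> B (Phi T)) ->
    (forall T, B T -> A (Psi T)) -> star_isomorphism A B Phi.
  move=> AB BA; split.
  - split=> // [S T _ _ /(can_inj PhiK)//|T BT].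
    by exists (Psi T); [exact: BA|exact: PsiK].
  - by move=> a S T _ _; exact: bop_transport_lin.
  - by move=> S T _ _; exact: bop_transport_comp.
  - by move=> S _; exact: bop_transport_adjoint.
exists Phi; split.
- by apply: iso => T; exact: entourage_bop_transport.
- by apply: iso => T; exact: uniform_roe_bop_transport.
- move=> _ [T diagT <-] [y y']; rewrite supp_bop_transport => /= /diagT.
  by rewrite /diagonal /= => /(can_inj gK).
Qed.
End BijectiveEquivalence.

(** * Images of the minimal projections *)

(** The explicit inverse makes the notion symmetric, so every result on [Phi] also holds for [Psi]
    by [roe_iso_sym]. *)
Record roe_iso (R : realType) (X Y : choiceType) (E : coarse_structure X)
    (F : coarse_structure Y) (A : set (bop R X)) (B : set (bop R Y))
    (Phi : bop R X -> bop R Y) (Psi : bop R Y -> bop R X) : Prop := RoeIso {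
  iso_algl : roe_algebra E A;
  iso_algr : roe_algebra F B;
  iso_mem : forall S, A S -> B (Phi S);
  iso_inv_mem : forall T, B T -> A (Psi T);
  iso_lin : forall a S T, A S -> A T -> Phi (a *: S + T) = a *: Phi S + Phi T;
  iso_comp : forall S T, A S -> A T ->
    Phi (bop_comp S T) = bop_comp (Phi S) (Phi T);
  iso_adjoint : forall S, A S -> Phi (adjoint S) = adjoint (Phi S);
  iso_can : forall S, A S -> Psi (Phi S) = S;
  iso_inv_can : forall T, B T -> Phi (Psi T) = T }.

Lemma roe_iso_sym (R : realType) (X Y : choiceType) (E : coarse_structure X)
    (F : coarse_structure Y) (A : set (bop R X)) (B : set (bop R Y)) Phi Psi :
  roe_iso E F A B Phi Psi -> roe_iso F E B A Psi Phi.
Proof.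
case=> algA algB AB BA lin comp adj can ican.
have inj S T : A S -> A T -> Phi S = Phi T -> S = T.
  by move=> AS AT ST; rewrite -(can _ AS) ST can.
split=> //.
- move=> a S T BS BT; have [AS AT] := (BA _ BS, BA _ BT).
  apply: inj; [by apply: BA; exact: (roe_lin algB)|exact: (roe_lin algA)|].
  by rewrite lin// !ican//; exact: (roe_lin algB).
- move=> S T BS BT; have [AS AT] := (BA _ BS, BA _ BT).
  apply: inj; [by apply: BA; exact: (roe_comp algB)|exact: (roe_comp algA)|].
  by rewrite comp// !ican//; exact: (roe_comp algB).
- move=> S BS; have AS := BA _ BS.
  apply: inj; [by apply: BA; exact: (roe_adjoint algB)|exact: (roe_adjoint algA)|].
  by rewrite adj// !ican//; exact: (roe_adjoint algB).
Qed.

Lemma star_isomorphism_roe_iso (R : realType) (X Y : choiceType)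
    (E : coarse_structure X) (F : coarse_structure Y)
    (A : set (bop R X)) (B : set (bop R Y)) Phi :
  roe_algebra E A -> roe_algebra F B -> star_isomorphism A B Phi ->
  exists Psi, roe_iso E F A B Phi Psi.
Proof.
move=> algA algB [[AB inj surj] lin comp adj].
have /choice[Psi PsiP] : forall T, exists S, B T -> A S /\ Phi S = T.
  (* [choice] wants a total relation; 0 is the default outside [B]. *)
  move=> T; have [BT|nBT] := pselect (B T); last by exists 0.
  by have [S AS ST] := surj _ BT; exists S.
have PsiA T : B T -> A (Psi T) by move=> /PsiP[].
have PsiK T : B T -> Phi (Psi T) = T by move=> /PsiP[].
exists Psi; split=> //.
by move=> S AS; apply: inj; rewrite ?inE//; [apply/PsiA/AB|apply/PsiK/AB].
Qed.

Section Projections.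
Variables (R : realType) (X Y : choiceType) (E : coarse_structure X).
Variables (F : coarse_structure Y) (A : set (bop R X)) (B : set (bop R Y)).
Variables (Phi : bop R X -> bop R Y) (Psi : bop R Y -> bop R X).
Hypothesis iso : roe_iso E F A B Phi Psi.

Let algA := iso_algl iso.
Let algB := iso_algr iso.

Let algA_mxunit := roe_mxunit algA.
Let algA0 := roe0 algA.

Lemma iso0 : Phi 0 = 0.
Proof.
have := iso_lin iso (-1) algA0 algA0; rewrite scaleN1r addNr => ->.
by rewrite scaleN1r addNr.
Qed.

Lemma isoZ a S : A S -> Phi (a *: S) = a *: Phi S.
Proof. by move=> AS; have := iso_lin iso a AS algA0; rewrite iso0 !addr0. Qed.

Lemma iso_neq0 S : A S -> S != 0 -> Phi S != 0.
Proof.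
move=> AS; apply: contraNneq => S0; rewrite -(iso_can iso AS) S0 -iso0.
by rewrite (iso_can iso algA0).
Qed.

Lemma iso_sum (I : Type) (s : seq I) (a : I -> R[i]) (G : I -> bop R X) :
  (forall i, A (G i)) ->
  A (\sum_(i <- s) a i *: G i) /\
  Phi (\sum_(i <- s) a i *: G i) = \sum_(i <- s) a i *: Phi (G i).
Proof.
move=> AG; elim: s => [|i s [As IHs]]; first by rewrite !big_nil iso0; split; [exact: algA0|].
by rewrite !big_cons (iso_lin iso)// IHs; split=> //; exact: (roe_lin algA).
Qed.

Definition imgproj x : bop R Y := Phi (mxunit R x x).

Lemma roe_imgproj x : B (imgproj x).
Proof. exact/(iso_mem iso)/algA_mxunit. Qed.

(** On the side of [X] the product is a compression between coordinate lines, which retains one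
    entry of [Psi T]. *)
Lemma imgproj_sandwich T x x' : B T ->
  bop_comp (imgproj x') (bop_comp T (imgproj x)) =
  Phi (Psi T (delta R x) x' *: mxunit R x x').
Proof.
move=> BT; have AT := iso_inv_mem iso BT.
rewrite -comp_mxunit2 (iso_comp iso); last 2 first.
- exact: algA_mxunit.
- by apply: (roe_comp algA) => //; exact: algA_mxunit.
by rewrite (iso_comp iso AT (algA_mxunit x)) (iso_inv_can iso BT).
Qed.

Lemma imgproj_comp x x' : bop_comp (imgproj x') (imgproj x) = if x == x' then imgproj x else 0.
Proof.
rewrite -(iso_comp iso (algA_mxunit _) (algA_mxunit _)).
have [->|xx'] := eqVneq x x'; last rewrite -iso0; congr (Phi _);
  apply: bop_ext => f; rewrite comp_mxunitl mxunitE l2ZE deltaE.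
  by rewrite eqxx mulr1.
by rewrite eq_sym (negPf xx') mulr0 scale0r.
Qed.

Lemma imgproj_herm x z z' : imgproj x (delta R z) z' = (imgproj x (delta R z') z)^*%C.
Proof. by rewrite -adjoint_entry -(iso_adjoint iso (algA_mxunit x)) adjoint_mxunit. Qed.

(* Compressing [mxunit R y y] by the minimal projection [imgproj x] gives a scalar
   multiple of [imgproj x]. *)
Lemma imgproj_mul x y z z' :
  imgproj x (delta R z) y * imgproj x (delta R y) z' =
  Psi (mxunit R y y) (delta R x) x * imgproj x (delta R z) z'.
Proof.
have := imgproj_sandwich x x (roe_mxunit algB y); rewrite isoZ; last exact: algA_mxunit.
move=> /(congr1 (fun T : bop R Y => T (delta R z) z')).
by rewrite !bop_compE mxunitE bopZ.
Qed.

(* [y] lies in the set [S x] of the proof idea above. *)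
Definition linked x y := imgproj x (delta R y) y != 0.

Lemma conjc_neq0 (z : R[i]) : z != 0 -> z^*%C != 0.
Proof. by apply: contraNneq => z0; rewrite -[z]conjcK z0 conjc0. Qed.

(** By hermitian symmetry both entries between [y] and [z] are nonzero, and [imgproj_mul] factors
    their product into the two quantities claimed nonzero. *)
Let nonzero x y z : imgproj x (delta R y) z != 0 ->
  linked x z /\ Psi (mxunit R y y) (delta R x) x != 0.
Proof.
move=> pyz; have pzy : imgproj x (delta R z) y != 0 by rewrite imgproj_herm conjc_neq0.
have := mulf_neq0 pzy pyz; rewrite imgproj_mul mulf_eq0 negb_or => /andP[? ?].
by split.
Qed.

(** The right-hand side is [linked] for [Psi] with [x] and [y] exchanged. For the converse,
    multiplying it by any nonzero entry of [imgproj x] exhibits a nonzero entry at [y]. *)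
Lemma linkedE x y : linked x y = (Psi (mxunit R y y) (delta R x) x != 0).
Proof.
apply/idP/idP => [/nonzero[]//|c0].
have [z [z' pz]] := bop_neq0 (iso_neq0 (algA_mxunit x) (mxunit_neq0 R x x)).
have := mulf_neq0 c0 pz; rewrite -imgproj_mul mulf_eq0 negb_or => /andP[+ _].
by case/nonzero.
Qed.

(** As for a rank-one projection, the support is a full square: a zero entry between linked points
    would, by [imgproj_mul], annihilate a product of two nonzero factors. *)
Lemma imgproj_entry_neq0 x z z' :
  (imgproj x (delta R z) z' != 0) = linked x z && linked x z'.
Proof.
apply/idP/andP => [pzz'|[lz lz']].
  have [? _] := nonzero pzz'; split=> //.
  have pz'z : imgproj x (delta R z') z != 0 by rewrite imgproj_herm conjc_neq0.
  by have [] := nonzero pz'z.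
apply/negP => /eqP pzz'; have := imgproj_mul x z z' z'.
rewrite pzz' mulr0 => /esym/eqP; rewrite mulf_eq0 => /orP[|/eqP pz'].
  by apply/negP; rewrite -linkedE.
by move: lz'; rewrite /linked pz' eqxx.
Qed.

Lemma linked_ex x : exists y, linked x y.
Proof.
have [z [z']] := bop_neq0 (iso_neq0 (algA_mxunit x) (mxunit_neq0 R x x)).
by rewrite -[Phi _]/(imgproj x) imgproj_entry_neq0 => /andP[? _]; exists z.
Qed.

Lemma imgproj_coord_neq0 x f z : imgproj x f z != 0 -> linked x z.
Proof.
move=> h; apply: contraNT h => nl; apply/eqP; apply: bop_eq0P => t _.
by apply/eqP/negP => /negP; rewrite imgproj_entry_neq0 (negPf nl) andbF.
Qed.

End Projections.

Section LinkedFinite.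
Variables (R : realType) (X Y : choiceType) (E : coarse_structure X).
Variables (F : coarse_structure Y).
Variables (Phi : bop R X -> bop R Y) (Psi : bop R Y -> bop R X).
Hypothesis iso : roe_iso E F (algebraic_uniform_roe R E) (algebraic_uniform_roe R F) Phi Psi.

(** The support of [imgproj Phi x] is an entourage, and its section at one linked point contains all
    linked points. *)
Lemma linked_finite (ulfF : uniformly_locally_finite F) :
  exists S : X -> seq Y, (forall x, uniq (S x)) /\ forall x y, linked Phi x y = (y \in S x).
Proof.
have finS x : finite_set [set y | linked Phi x y].
  have [y0 l0] := linked_ex iso x.
  have [n nP] := ulfF _ (roe_imgproj iso x).
  apply: (card_le_finite _ (finite_II n)); apply: card_le_trans (nP y0).
  apply: subset_card_le => y ly; apply/suppE.
  by rewrite (imgproj_entry_neq0 iso) l0.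
exists (fun x => fset_set [set y | linked Phi x y] : seq Y); split=> [x|x y].
  exact: fset_uniq.
by rewrite in_fset_set//; apply/idP/idP => [l|/set_mem//]; exact: mem_set.
Qed.
End LinkedFinite.

Lemma linked_sym (R : realType) (X Y : choiceType) (E : coarse_structure X)
  (F : coarse_structure Y) (A : set (bop R X)) (B : set (bop R Y)) Phi Psi :
  roe_iso E F A B Phi Psi -> forall x y, linked Phi x y = linked Psi y x.
Proof. by move=> iso x y; rewrite (linkedE iso). Qed.

Lemma l2_finite_expansion (R : realType) (X : choiceType) (T : bop R X) (f : l2 R X)
    (s : seq X) y : uniq s -> (forall x, f x != 0 -> x \in s) ->
  T f y = \sum_(x <- s) f x * T (delta R x) y.
Proof.
move=> us fs; have [xi [xiE _ xiL]] := finite_approx f us.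
have -> : T f = T xi.
  congr (T _ : l2 R X); apply: l2_ext => x; rewrite xiE; case: ifPn => // xs.
  by apply/eqP; apply: contraNT xs; exact: fs.
by rewrite (xiL (fun f => T f y))// => a g h; rewrite bop_linear.
Qed.

(** * Control of the squares, selection of points, and coarseness *)

Section Rigidity.
Variables (R : realType) (X Y : choiceType) (E : coarse_structure X).
Variables (F : coarse_structure Y) (A : set (bop R X)) (B : set (bop R Y)).
Variables (Phi : bop R X -> bop R Y) (Psi : bop R Y -> bop R X).
Hypothesis iso : roe_iso E F A B Phi Psi.
Variables (S : X -> seq Y) (T : Y -> seq X).
Hypothesis SE : forall x y, linked Phi x y = (y \in S x).
Hypothesis uniqT : forall y, uniq (T y).
Hypothesis TE : forall x y, linked Phi x y = (x \in T y).

(** Linearity suffices for the infinite diagonal [D]: on the range of [imgproj Psi z], which lives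
    on [T z], it agrees with the finite sum [G]. *)
Lemma iso_diag_entry (D : bop R X) (a : X -> R[i]) z z' :
  (forall f x, D f x = a x * f x) ->
  Phi D (delta R z) z' = \sum_(x <- T z) a x * imgproj Phi x (delta R z) z'.
Proof.
move=> DE.
have AD : A D.
  apply: (roe_diag (iso_algl iso)) => -[x y] /suppE; rewrite DE deltaE.
  by have [->//|_] := eqVneq y x; rewrite mulr0 eqxx.
have isoY := roe_iso_sym iso.
have AQ : A (imgproj Psi z) := roe_imgproj isoY z.
have [AG GE] := iso_sum iso (T z) a (roe_mxunit (iso_algl iso)).
set G := \sum_(x <- _) _ in AG GE.
have sumE U (H : X -> bop R U) f y :
    (\sum_(x <- T z) a x *: H x) f y = \sum_(x <- T z) a x * H x f y.
  elim: (T z) => [|x s IHs]; first by rewrite !big_nil.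
  by rewrite !big_cons bopDE l2DE IHs.
have DG : bop_comp D (imgproj Psi z) = bop_comp G (imgproj Psi z).
  apply: bop_ext => f; apply: l2_ext => x; rewrite !bop_compE DE sumE.
  rewrite (eq_bigr (fun y => a y * (imgproj Psi z f y * (x == y)%:R)))//.
  have [xz|xz] := boolP (x \in T z).
    rewrite (bigD1_seq x)//= big1 ?addr0 => [|y yx].
      by rewrite eqxx mulr1.
    by rewrite eq_sym (negPf yx) !mulr0.
  have -> : imgproj Psi z f x = 0.
    apply/eqP; apply: contraNT xz => /(imgproj_coord_neq0 isoY).
    by rewrite -TE (linked_sym iso).
  rewrite mulr0 big_seq big1// => y yz.
  have [yx|yx] := eqVneq x y; first by rewrite -yx (negPf xz) in yz.
  by rewrite !mulr0.
have : bop_comp (Phi D) (mxunit R z z) = bop_comp (Phi G) (mxunit R z z).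
  rewrite -(iso_inv_can iso (roe_mxunit (iso_algr iso) z)) -!(iso_comp iso)//.
  by rewrite -[Psi _]/(imgproj Psi z) DG.
move=> /(congr1 (fun U : bop R Y => U (delta R z) z')).
by rewrite !bop_compE mxunitE deltaE eqxx scale1r GE sumE.
Qed.

Lemma linked_entourage : exists2 D, A D &
  forall x z z', linked Phi x z -> linked Phi x z' -> supp (Phi D) (z, z').
Proof.
(* Infinitely many distinct weights of modulus at most 1, so that the diagonal operator is
   bounded. *)
pose v n : R[i] := ((n.+1)%:R^-1 : R)%:C.
have vI : injective v.
  by move=> m n /complexI/invr_inj/eqP; rewrite eqr_nat => /eqP[].
pose c (j : Y * Y) x := imgproj Phi x (delta R j.1) j.2.
have cE j x : (c j x != 0) = (j.1 \in S x) && (j.2 \in S x).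
  by rewrite -!SE (imgproj_entry_neq0 iso).
have [||n nP] := @generic_weights _ _ _ v c (fun j => T j.1)
    (fun x => [seq (z, z') | z <- S x, z' <- S x]) vI (fun j => uniqT _).
- by move=> j x; rewrite cE -SE -TE => /andP[].
- by move=> [z z'] x; rewrite cE => /andP[zS z'S]; apply/allpairsP; exists (z, z').
have [|D DE] := @diag_operator R X (fun x => v (n x)).
  move=> x; rewrite normc_real ?invr_ge0//.
  by rewrite invf_le1 ?ltr0n// ler1n.
exists D.
  apply: (roe_diag (iso_algl iso)) => -[x y] /suppE; rewrite DE deltaE.
  by have [->//|_] := eqVneq y x; rewrite mulr0 eqxx.
move=> x z z' lz lz'; apply/suppE; rewrite (iso_diag_entry _ _ DE).
by apply: (nP (z, z') x); rewrite cE -!SE lz lz'.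
Qed.

Lemma linked_selection : exists2 f : X -> Y, injective f & forall x, linked Phi x (f x).
Proof.
suff [f fI fS] : exists2 f : X -> Y, injective f & forall x, f x \in S x.
  by exists f => // x; rewrite SE.
apply: injective_selection => s.
have [y yP] := choice (linked_ex iso).
(* Row [i] of [M] lists the coordinates over [Z] of a nonzero vector in the range of [p i]; a
   nonzero entry in it names a point of [S (ux i)]. *)
pose u := undup s; pose Z := undup (flatten (map S u)).
pose ux i := tnth (in_tuple u) i; pose zz j := tnth (in_tuple Z) j.
pose p i := imgproj Phi (ux i); pose yy i := y (ux i).
pose M := \matrix_(i < size u, j < size Z) p i (delta R (yy i)) (zz j).
pose N := \matrix_(j < size Z, i < size u)
  (p i (delta R (zz j)) (yy i) / p i (delta R (yy i)) (yy i)).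
(* [N] is a right inverse of [M]: the [p i] are orthogonal idempotents. *)
have freeM : row_free M.
  apply/row_freeP; exists N; apply/matrixP => i k; rewrite !mxE.
  transitivity (bop_comp (p k) (p i) (delta R (yy i)) (yy k) /
                p k (delta R (yy k)) (yy k)).
    rewrite bop_compE (@l2_finite_expansion _ _ _ _ Z) ?undup_uniq//; last first.
      move=> z /(imgproj_coord_neq0 iso); rewrite SE mem_undup => zS.
      by apply/flatten_mapP; exists (ux i) => //; exact: mem_tnth.
    rewrite mulr_suml (big_tnth _ _ Z); apply: eq_bigr => j _.
    by rewrite !mxE mulrA.
  rewrite (imgproj_comp iso); have -> : (ux i == ux k) = (i == k).
    apply/eqP/eqP => [|->//]; have x0 := ux i.
    rewrite /ux !(tnth_nth x0) /=.
    by move/eqP; rewrite nth_uniq ?undup_uniq// => /eqP/val_inj.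
  have [<-|_] := eqVneq i k; last by rewrite mul0r.
  by rewrite divff//; exact: yP.
have [g gI gP] := row_free_injection freeM.
(* Outside [s] the index equals [size u], [insub] fails, and [y x] is the default. *)
pose h x := if insub (index x u) is Some i then zz (g i) else y x.
have hE x : x \in s -> exists2 i, ux i = x & h x = zz (g i).
  rewrite -mem_undup -/u => xu; have iu : (index x u < size u)%N by rewrite index_mem.
  exists (Ordinal iu); first by rewrite /ux (tnth_nth x) /= nth_index.
  by rewrite /h insubT.
exists h; split=> [x x' /hE[i <- ->] /hE[j <- ->]|x /hE[i <- ->]].
  have z0 := zz (g i); rewrite /zz !(tnth_nth z0) /= => /eqP.
  by rewrite nth_uniq ?undup_uniq// => /eqP/val_inj/gI ->.
by have := gP i; rewrite mxE (imgproj_entry_neq0 iso) -SE => /andP[].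
Qed.

(** For (x, x') in the entourage, [Phi W] cut down by the projections of [x] and [x'] is nonzero, so
    it has an entry from some [w] linked to [x] to some [w'] linked to [x']. The path f x, w, w', f
    x' runs through the supports of [Phi D], [Phi W] and [Phi D]. *)
Lemma linked_coarse_map (f : X -> Y) (ulfE : uniformly_locally_finite E) :
  (forall T, B T -> F (supp T)) -> (forall x, linked Phi x (f x)) -> coarse_map E F f.
Proof.
move=> BF fl A0 EA0; have [W WE] := entourage_operator R ulfE EA0.
have AW : A W.
  apply: (roe_supp (iso_algl iso)); apply: coarse_sub EA0 => -[x x'] /suppE.
  by rewrite WE; have [/asboolP//|] := boolP `[< _ >]; rewrite eqxx.
have [D AD DP] := linked_entourage.
have FD : F (supp (Phi D)) by apply: BF; exact: (iso_mem iso).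
have FW : F (supp (Phi W)) by apply: BF; exact: (iso_mem iso).
eexists; first exact: coarse_comp FD (coarse_comp FW FD).
move=> x x' /asboolT Axx'; have := imgproj_sandwich iso x x' (iso_mem iso AW).
rewrite (iso_can iso AW) WE Axx' scale1r => pE.
have Ae : A (mxunit R x x').
  apply: (roe_supp (iso_algl iso)); apply: coarse_sub EA0.
  by rewrite supp_mxunit => _ ->; apply/asboolP.
have [t [t']] := bop_neq0 (iso_neq0 iso Ae (mxunit_neq0 R x x')); rewrite -pE !bop_compE => nz.
(* A nonzero entry of the triple product passes through intermediate points [w] and [w'] at which
   every factor is nonzero. *)
have [w' Gw' pw'] : exists2 w', Phi W (imgproj Phi x (delta R t)) w' != 0 &
    imgproj Phi x' (delta R w') t' != 0.
  apply: contrapT => none; move/eqP: nz; apply; apply: bop_eq0P => w' Gw'.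
  by apply/eqP/negP => /negP pw'; apply: none; exists w'.
have [w pw Gw] : exists2 w, imgproj Phi x (delta R t) w != 0 & Phi W (delta R w) w' != 0.
  apply: contrapT => none; move/eqP: Gw'; apply; apply: bop_eq0P => w pw.
  by apply/eqP/negP => /negP Gw; apply: none; exists w.
have lw := imgproj_coord_neq0 iso pw.
move: pw'; rewrite (imgproj_entry_neq0 iso) => /andP[lw' _].
exists w; split; first exact: DP (fl x) lw.
by exists w'; split; [exact/suppE|exact: DP lw' (fl x')].
Qed.
End Rigidity.

(** * Rigidity *)

Lemma inverse_coarse_equivalence (X Y : Type) (E : coarse_structure X)
    (F : coarse_structure Y) (f : X -> Y) (g : Y -> X) : cancel f g -> cancel g f ->
  coarse_map E F f -> coarse_map F E g -> bijectively_coarsely_equivalent E F.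
Proof.
move=> fK gK cf cg; exists f; last by exists g.
split=> //; exists g; split=> //.
- by apply: coarse_sub (coarse_diag E) => _ [x _ <-]; rewrite /diagonal /= fK.
- by apply: coarse_sub (coarse_diag F) => _ [y _ <-]; rewrite /diagonal /= gK.
Qed.

Lemma algebraic_iso_equivalence (R : realType) (X Y : choiceType)
    (E : coarse_structure X) (F : coarse_structure Y) Phi :
  uniformly_locally_finite E -> uniformly_locally_finite F ->
  star_isomorphism (algebraic_uniform_roe R E) (algebraic_uniform_roe R F) Phi ->
  bijectively_coarsely_equivalent E F.
Proof.
move=> ulfE ulfF sPhi.
have [Psi iso] := star_isomorphism_roe_iso
  (algebraic_roe_algebra R E) (algebraic_roe_algebra R F) sPhi.
have isoY := roe_iso_sym iso; have lsym := linked_sym iso.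
have [S [uS SE]] := linked_finite iso ulfF.
have [T [uT TE]] := linked_finite isoY ulfE.
have TE' x y : linked Phi x y = (x \in T y) by rewrite lsym TE.
have SE' y x : linked Psi y x = (y \in S x) by rewrite -lsym SE.
have [f0 f0I f0l] := linked_selection iso SE.
have [g0 g0I g0l] := linked_selection isoY TE.
have [f [g fK gK] fP] := Cantor_Bernstein_graph f0I g0I.
(* Each pair (x, f x) comes from [f0] or, reversed, from [g0]; both lie in the symmetric relation
   [linked]. *)
have fl x : linked Phi x (f x).
  by have [->//|xE] := fP x; rewrite lsym {2}xE.
have gl y : linked Psi y (g y) by rewrite -lsym -{2}(gK y).
apply: (inverse_coarse_equivalence fK gK).
  by apply: (linked_coarse_map iso SE uT TE' ulfE) => // T0.
by apply: (linked_coarse_map isoY TE uS SE' ulfF) => // T0.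
Qed.

(** * The diagonal-preserving case *)

Section DiagonalRigidity.
Variables (R : realType) (X Y : choiceType) (E : coarse_structure X).
Variables (F : coarse_structure Y).
Variables (Phi : bop R X -> bop R Y) (Psi : bop R Y -> bop R X).
Hypothesis iso : roe_iso E F (uniform_roe R E) (uniform_roe R F) Phi Psi.

Lemma mxunit_coarse_map (f : X -> Y) (ulfE : uniformly_locally_finite E) :
  (forall x, Phi (mxunit R x x) = mxunit R (f x) (f x)) -> coarse_map E F f.
Proof.
move=> fE A0 EA0; have [W WE] := entourage_operator R ulfE EA0.
have AW : uniform_roe R E W.
  apply: (roe_supp (iso_algl iso)); apply: coarse_sub EA0 => -[x x'] /suppE.
  by rewrite WE; have [/asboolP//|] := boolP `[< _ >]; rewrite eqxx.
(* The relevant entries of [Phi W] have modulus 1, so a squared error of 1/2 cannot hide them: the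
   support of [S] is the wanted entourage. *)
have /uniform_roeP/(_ (1 / 2))[|S FS SW] := iso_mem iso AW; first by lra.
exists (supp S) => // x x' Axx'; apply/suppE.
have Ae : uniform_roe R E (mxunit R x x').
  apply: (roe_supp (iso_algl iso)); apply: coarse_sub EA0.
  by rewrite supp_mxunit => _ ->.
pose c := Phi W (delta R (f x)) (f x').
have vE : Phi (mxunit R x x') = c *: mxunit R (f x) (f x').
  have := imgproj_sandwich iso x x' (iso_mem iso AW).
  rewrite (iso_can iso AW) WE (asboolT Axx') scale1r => <-.
  by rewrite /imgproj !fE comp_mxunit2.
(* The matrix unit is a partial isometry: [Phi] applied to its product with its adjoint gives |c|^2
   = 1. *)
have c1 : c^*%C * c = 1.
  have ee : bop_comp (adjoint (mxunit R x x')) (mxunit R x x') = mxunit R x x.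
    apply: bop_ext => g; rewrite adjoint_mxunit comp_mxunitl mxunitE l2ZE deltaE.
    by rewrite eqxx mulr1.
  have := congr1 Phi ee.
  rewrite (iso_comp iso (roe_adjoint (iso_algl iso) Ae) Ae) (iso_adjoint iso Ae) vE fE.
  move=> /(congr1 (fun T : bop R Y => T (delta R (f x)) (f x))).
  rewrite adjointZ adjoint_mxunit bop_compE !bopZE !mxunitE !l2ZE !deltaE !eqxx.
  by rewrite !mulr1.
have n1 : normc c ^+ 2 = 1.
  move: c c1 {vE} => [a b] /eqP; rewrite eq_complex => /andP[/eqP h _].
  by rewrite Defs.sqr_normc; move: h => /= h; lra.
apply/eqP => S0.
have := le_trans (nsq_ge _ (f x')) (SW (delta R (f x))).
rewrite nsq_delta mulr1 -scaleN1r l2DE l2ZE S0 mulr0 addr0 -/c n1; lra.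
Qed.
End DiagonalRigidity.

Lemma uniform_iso_equivalence (R : realType) (X Y : choiceType)
    (E : coarse_structure X) (F : coarse_structure Y) Phi :
  uniformly_locally_finite E -> uniformly_locally_finite F ->
  star_isomorphism (uniform_roe R E) (uniform_roe R F) Phi ->
  Phi @` linfty R X `<=` linfty R Y ->
  bijectively_coarsely_equivalent E F.
Proof.
move=> ulfE ulfF sPhi diagPhi.
have [Psi iso] := star_isomorphism_roe_iso
  (uniform_roe_algebra R E) (uniform_roe_algebra R F) sPhi.
have isoY := roe_iso_sym iso; have lsym := linked_sym iso.
(* The image of [mxunit x x] is diagonal while its support is a full square, so the square is a
   single point. *)
have luniq x y z : linked Phi x y -> linked Phi x z -> y = z.
  move=> ly lz; have /(_ (y, z)) : supp (imgproj Phi x) `<=` diagonal.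
    apply: diagPhi; exists (mxunit R x x) => //.
    by rewrite /linfty /= supp_mxunit => _ ->.
  by apply; apply/suppE; rewrite (imgproj_entry_neq0 iso) ly.
have [f fl] := choice (linked_ex iso); have [g gl] := choice (linked_ex isoY).
have fE x : Phi (mxunit R x x) = mxunit R (f x) (f x).
  pose p := imgproj Phi x (delta R (f x)) (f x).
  have pE : imgproj Phi x = p *: mxunit R (f x) (f x).
    apply: bop_ext_delta => z; apply: l2_ext => t; rewrite bopZE l2ZE mxunit_entry.
    have [[-> ->]|nzt] := pselect (z = f x /\ t = f x); first by rewrite !eqxx mulr1.
    have -> : (z == f x) && (t == f x) = false.
      by apply/negP => /andP[/eqP zx /eqP tx]; apply: nzt.
    rewrite mulr0; apply/eqP/negP => /negP; rewrite (imgproj_entry_neq0 iso) => /andP[lz lt].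
    by apply: nzt; split; [exact: luniq lz (fl x)|exact: luniq lt (fl x)].
  have p0 : p != 0 := fl x.
  (* Idempotence gives p * p = p, and the nonzero scalar [p] is 1. *)
  have := imgproj_comp iso x x; rewrite eqxx pE.
  move=> /(congr1 (fun T : bop R Y => T (delta R (f x)) (f x))).
  rewrite bop_compE !bopZE !mxunitE !l2ZE !deltaE !eqxx !mulr1.
  by rewrite -[X in _ = X]mulr1 => /(mulfI p0) p1; rewrite -[LHS]/(imgproj Phi x) pE p1 scale1r.
have gK : cancel g f.
  by move=> y; apply: luniq (fl (g y)) _; rewrite lsym.
have fK : cancel f g.
  move=> x; apply/eqP/negPn/negP => gfx.
  (* Were [g (f x)] different from [x], two orthogonal projections would have the same nonzero
     image. *)
  have := imgproj_comp iso x (g (f x)); rewrite eq_sym (negPf gfx).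
  rewrite /imgproj !fE gK => /(congr1 (fun T : bop R Y => T (delta R (f x)) (f x))).
  rewrite bop_compE !mxunitE !l2ZE !deltaE !eqxx bop0E l20E !mulr1.
  by move/eqP; rewrite oner_eq0.
(* The diagonal hypothesis concerns [Phi]; the behaviour of [Psi] on the projections is recovered
   from [fE] and [gK]. *)
have gE y : Psi (mxunit R y y) = mxunit R (g y) (g y).
  by rewrite -{1 2}(gK y) -fE (iso_can iso)//; exact: roe_mxunit (iso_algl iso) _.
apply: (inverse_coarse_equivalence fK gK).
  exact: (mxunit_coarse_map iso ulfE fE).
exact: (mxunit_coarse_map isoY ulfF gE).
Qed.

Theorem theorem8p1 (R : realType) (X Y : choiceType)
    (E : coarse_structure X) (F : coarse_structure Y)
    (ulfE : uniformly_locally_finite E) (ulfF : uniformly_locally_finite F) :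
  [<-> bijectively_coarsely_equivalent E F;
       exists Phi : bop R X -> bop R Y,
         star_isomorphism (algebraic_uniform_roe R E)
                          (algebraic_uniform_roe R F) Phi;
       exists Phi : bop R X -> bop R Y,
         star_isomorphism (uniform_roe R E) (uniform_roe R F) Phi /\
         Phi @` linfty R X `<=` linfty R Y ].
Proof.
split=> [/(bijective_equivalence_iso R)[Phi [algPhi _ _]]|]; first by exists Phi.
split=> [[Phi /(algebraic_iso_equivalence ulfE ulfF)]|[Phi [uPhi diagPhi]]].
  (* The second condition yields the third by way of the first: the isomorphism of uniform Roe
     algebras comes from the bijection. *)
  by move=> /(bijective_equivalence_iso R)[Psi [_ uPsi diagPsi]]; exists Psi.
exact: uniform_iso_equivalence ulfE ulfF uPhi diagPhi.
Qed.
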